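(* Let $M>0$, and let $\gamma,\kappa\in(0,1)$ be such that $\gamma+\kappa>1$. Assume that $\varepsilon>0$ and $p\ge1$ satisfy $\varepsilon>\frac1{2p}$ and let $x\in\mathcal{C}^{\gamma+\varepsilon}$. Suppose that $\sigma:\mathbb{R}\to\mathbb{R}$ is bounded, belongs to $C^2(\mathbb{R})$ and has bounded derivatives. Suppose also that $\sigma$ satisfies $$\|\sigma^{(j)}\|_\infty\le\frac{c_1}{M+1},\qquad j=0,1,2,$$ for a small enough constant $c_1<1$. Then there exists a unique solution $z$ in $\mathcal{C}^\kappa$, with $z_0=0$, of the equation $$z_t-z_s=\int_s^t du\left(\int_u^1\sigma_M(x,z_\xi)\,dx_\xi\right)-(t-s)\int_0^1\xi\,\sigma_M(x,z_\xi)\,dx_\xi,\qquad 0\le s\le t\le1.$$ Moreover, it holds that $$\|z\|_\kappa\le C(M),$$ where $C(M)$ is a positive constant depending on $M$.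
   Context: $\mathcal{C}^\gamma$ is the space of continuous $f:[0,1]\to\mathbb{R}$ with $\|f\|_\gamma:=\|f\|_\infty+\sup_{0\le s<t\le1}\frac{|f_t-f_s|}{|t-s|^\gamma}<\infty$. Integrals $\int g\,df$ with $f\in\mathcal{C}^\gamma$, $g\in\mathcal{C}^\kappa$, $\gamma+\kappa>1$, are Young integrals (limits of Riemann sums along partitions). For $p\ge1$ put $$\|f\|_{\gamma,p}:=\left(\int_0^1\int_0^1\frac{(f(\zeta)-f(\eta))^{2p}}{|\zeta-\eta|^{2p\gamma+2}}\,d\zeta\,d\eta\right)^{\frac1{2p}}$$ (for non-integer $p$, $a^{2p}$ means $|a|^{2p}$). If $\varepsilon>\frac1{2p}$, then $f\in\mathcal{C}^{\gamma+\varepsilon}$ implies $\|f\|_{\gamma,p}<\infty$. Cutoff: $\varphi_M\in C^\infty_b((0,\infty))$ is a function such that $\varphi_M(r)=0$ for all $r>M+1$ and $\varphi_M(r)=1$ for $r<M$ (also read as $\varphi_M(0)=1$). For $x$ with $\|x\|_{\gamma,p}<\infty$ and $y\in\mathbb{R}$, set $G_M(x):=\varphi_M(\|x\|_{\gamma,p}^{2p})$ and $\sigma_M(x,y):=G_M(x)\,\sigma(y)$. *)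

(* Defs.v *)
From HB Require Import structures.
From mathcomp Require Import all_boot all_order all_algebra.
From mathcomp Require Import all_classical all_reals all_analysis.
Set Implicit Arguments.
Unset Strict Implicit.
Unset Printing Implicit Defensive.
Import Order.TTheory GRing.Theory Num.Theory.
Import numFieldNormedType.Exports.
Local Open Scope classical_set_scope.
Local Open Scope ring_scope.

(* Functions on [0, 1] are represented by total functions R -> R; every notion
   below only looks at their values on [0, 1] (or on the subinterval at hand),
   so they are to be compared on [0, 1] only. *)

Section defs.
Context {R : realType}.
Implicit Types (f g x z sigma phi : R -> R) (A : set R).

Definition supnorm A f : \bar R := ereal_sup [set (`|f t|)%:E | t in A].

Definition holder_seminorm (gam : R) f : \bar R :=
  ereal_sup [set e | exists s t : R, [/\ 0 <= s, s < t, t <= 1 &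
    e = (`|f t - f s| / `|t - s| `^ gam)%:E]].

Definition holder_norm (gam : R) f : \bar R :=
  (supnorm `[0%R, 1%R] f + holder_seminorm gam f)%E.

Definition holder_space (gam : R) : set (R -> R) :=
  [set f : R -> R | {within `[0, 1], continuous f} /\ (holder_norm gam f < +oo)%E].

(* (a = t_0 < t_1 < ... < t_n = b) is the list a :: s, and tau i is the tag
   chosen in [t_i, t_(i+1)]. *)
Definition is_young_integral g f (a b I : R) : Prop :=
  forall e : R, 0 < e -> exists2 d : R, 0 < d &
    forall (s : seq R) (tau : nat -> R), itv_partition a b s ->
      let t := nth b (a :: s) in
      (forall i, (i < size s)%N ->
        t i.+1 - t i < d /\ t i <= tau i <= t i.+1) ->
      `|\sum_(0 <= i < size s) g (tau i) * (f (t i.+1) - f (t i)) - I| < e.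

(* The value of \int_a^b g df; it is arbitrary when the limit of the Riemann
   sums does not exist. *)
Definition young_integral g f (a b : R) : R :=
  get [set I | is_young_integral g f a b I].

(* On the diagonal, which is negligible, the integrand is 0 / 0 = 0. *)
Definition gp_norm (gam p : R) f : \bar R :=
  ((\int[lebesgue_measure]_(zeta in `[0%R, 1%R])
      \int[lebesgue_measure]_(eta in `[0%R, 1%R])
        (`|f zeta - f eta| `^ (2 * p) /
         `|zeta - eta| `^ (2 * p * gam + 2))%:E) `^ (2 * p)^-1)%E.

(* Only the values of phi on [0, +oo[ matter; derive1n n phi at r > 0 depends only on
   the restriction of phi to ]0, +oo[. *)
Definition is_cutoff (M : R) phi : Prop :=
  [/\ forall (n : nat) (r : R), 0 < r -> derivable (derive1n n phi) r 1,
      forall n : nat, (supnorm `]0%R, +oo[ (derive1n n phi) < +oo)%E,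
      forall r : R, M + 1 < r -> phi r = 0 &
      forall r : R, 0 <= r -> r < M -> phi r = 1].

Definition G_cut phi (gam p : R) x : R := phi (fine (gp_norm gam p x) `^ (2 * p)).

Definition sigma_cut phi (gam p : R) sigma x (y : R) : R :=
  G_cut phi gam p x * sigma y.

Definition bounded_C2 sigma : Prop :=
  [/\ forall (j : nat) (y : R), (j < 2)%N -> derivable (derive1n j sigma) y 1,
      continuous (derive1n 2 sigma) &
      forall j : nat, (j <= 2)%N -> (supnorm setT (derive1n j sigma) < +oo)%E].

Definition is_solution phi (gam p : R) sigma x (kap : R) z : Prop :=
  [/\ holder_space kap z, z 0 = 0 &
      forall s t : R, 0 <= s -> s <= t -> t <= 1 ->
        z t - z s =
          \int[lebesgue_measure]_(u in `[s, t])
             young_integral (fun xi => sigma_cut phi gam p sigma x (z xi)) x u 1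
          - (t - s) *
            young_integral
              (fun xi => xi * sigma_cut phi gam p sigma x (z xi)) x 0 1].

End defs.

(* Main.v *)
Require Import Defs.
From mathcomp Require Import all_boot all_order all_algebra.
From mathcomp Require Import all_classical all_reals all_analysis.
From mathcomp Require Import measurable_realfun.
From mathcomp Require Import ring lra.
Set Implicit Arguments.
Unset Strict Implicit.
Unset Printing Implicit Defensive.
Import Order.TTheory GRing.Theory Num.Theory.
Import numFieldNormedType.Exports.
Local Open Scope classical_set_scope.
Local Open Scope ring_scope.

(** Write [f]_k for the k-Hoelder seminorm on [0, 1].  The equation says that
    z is a fixed point of the map sending z to the solution, null at 0 and 1,
    of - y'' = G_M(x) sigma(z) dx, and this map is a contraction as soon as
    c1 is small.

    Two estimates make the contraction constant independent of x.  By Young's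
    inequality the integral of g against x over [a, b] is
    g(a) (x_b - x_a) up to C [g]_kap [x]_gam (b - a)^(gam + kap)
    (young_integral_exists), so that the image is Lipschitz with a constant
    controlled by (sup |g| + [g]_kap) [x]_gam (green_operator_bound).  By the
    Garsia-Rodemich-Rumsey inequality the seminorm ||x||_(gam, p) controls
    [x]_gam; since the cutoff vanishes unless ||x||_(gam, p)^(2p) <= M + 1,
    the product |G_M(x)| [x]_gam is at most a constant times M + 1, for every x
    (cutoff_holder_with).  The condition eps > 1 / (2p) ensures that
    ||x||_(gam, p) is finite (gagliardo_bound): an infinite seminorm would be
    read as 0 by the cutoff, which would then control nothing.

    The factor M + 1 is cancelled by the bound c1 / (M + 1) on sigma, sigma'
    and sigma''.  Because z_0 = 0, the seminorm [z]_kap dominates sup |z|, and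
    it is the only norm needed.  The bounds on sigma and sigma' turn
    [z]_kap <= H into (1 + H) / 4 for the image
    (green_operator_self_map); the bound on sigma'' enters when two
    compositions are compared in Hoelder norm (second_difference), and the map
    halves distances in the ball [z]_kap <= 1 (green_operator_contraction).
    Iterating H |-> (1 + H) / 4 puts every solution in that ball, where
    Picard's iteration gives existence and uniqueness (picard).  The bound on
    ||z||_kap is therefore 2. *)

(** * Real powers and geometric bounds *)

Lemma ler_powRl (R : realType) (r x y : R) :
  0 <= r -> 0 <= x -> x <= y -> x `^ r <= y `^ r.
Proof.
move=> r0 x0 xy; apply: ge0_ler_powR => //; rewrite nnegrE //.
exact: le_trans xy.
Qed.

Lemma powR_splitD (R : realType) (x r s : R) :
  0 < r -> 0 < s -> x `^ (r + s) = x `^ r * x `^ s.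
Proof. by move=> r0 s0; rewrite powRD// gt_eqF// addr_gt0. Qed.

Lemma powR_exprn (R : realType) (x r : R) n :
  0 <= x -> (x ^+ n) `^ r = (x `^ r) ^+ n.
Proof.
move=> x0; elim: n => [|n IH]; first by rewrite !expr0 powR1.
by rewrite !exprS powRM ?exprn_ge0// IH.
Qed.

Lemma powR_le1 (R : realType) (x r : R) :
  0 <= x -> x <= 1 -> 0 <= r -> x `^ r <= 1.
Proof. by move=> x0 x1 r0; have := ler_powRl r0 x0 x1; rewrite powR1. Qed.

Lemma ler_powRr (R : realType) (x r s : R) :
  0 <= x -> x <= 1 -> 0 < r -> r <= s -> x `^ s <= x `^ r.
Proof.
move=> x0 x1 r0; rewrite le_eqVlt => /predU1P[->//|rs].
rewrite -[s](subrK r) addrC powR_splitD ?subr_gt0//.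
by rewrite ler_piMr ?powR_ge0// powR_le1// subr_ge0 ltW.
Qed.

Lemma half_powR_lt1 (R : realType) (r : R) : 0 < r -> 2^-1 `^ r < 1 :> R.
Proof.
move=> r0; have := @gt0_ltr_powR R r r0 2^-1 1.
rewrite powR1; apply; rewrite ?nnegrE ?invr_ge0//; lra.
Qed.

Lemma geometric_lt (R : realType) (r c e : R) :
  0 <= r -> r < 1 -> 0 < e -> exists n : nat, c * r ^+ n < e.
Proof.
move=> r0 r1 e0.
have [c0|c0] := leP c 0.
  by exists 0%N; rewrite expr0 mulr1 (le_lt_trans c0).
have : (fun n => r ^+ n) @ \oo --> (0 : R).
  by apply: cvg_expr; rewrite ger0_norm.
move=> /cvgrPdist_lt /(_ (e / c)); rewrite divr_gt0// => /(_ isT)[n _ /(_ n)].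
rewrite /= leqnn => /(_ isT); rewrite sub0r normrN ger0_norm ?exprn_ge0// => h.
by exists n; rewrite mulrC -ltr_pdivlMr.
Qed.

Lemma ler_geometric (R : realType) (r c a b : R) :
  0 <= r -> r < 1 -> (forall n : nat, a <= b + c * r ^+ n) -> a <= b.
Proof.
move=> r0 r1 h; rewrite leNgt; apply/negP => ba.
have [n hn] := @geometric_lt R r c (a - b) r0 r1 (ltac:(by rewrite subr_gt0)).
have := h n; lra.
Qed.

(** The sequences u_n - d r^n and u_n + d r^n, with d = c / (1 - r), are
    respectively nondecreasing and nonincreasing, so the supremum of the first
    one is the limit and the error bound comes for free. *)
Lemma geometric_limit (R : realType) (u : nat -> R) (r c : R) :
  0 <= r -> r < 1 -> (forall n, `|u n.+1 - u n| <= c * r ^+ n) ->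
  exists l, forall n, `|u n - l| <= c / (1 - r) * r ^+ n.
Proof.
move=> r0 r1 h; pose d := c / (1 - r).
have r1' : 0 < 1 - r by lra.
have dE n : c * r ^+ n = d * r ^+ n - d * r ^+ n.+1.
  by rewrite exprS -mulrBr /d -{2}[r ^+ n]mul1r -mulrBl mulrA divfK ?gt_eqF.
have c0 : 0 <= c.
  by have := le_trans (normr_ge0 _) (h 0%N); rewrite expr0 mulr1.
have d0 n : 0 <= d * r ^+ n by rewrite mulr_ge0 ?exprn_ge0// divr_ge0// ltW.
have incr n k : u n - d * r ^+ n <= u (n + k)%N - d * r ^+ (n + k).
  elim: k => [|k IH]; first by rewrite addn0.
  apply: (le_trans IH); rewrite addnS.
  by have := h (n + k)%N; have := dE (n + k)%N; rewrite ler_norml; lra.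
have decr n k : u (n + k)%N + d * r ^+ (n + k) <= u n + d * r ^+ n.
  elim: k => [|k IH]; first by rewrite addn0.
  apply: le_trans IH; rewrite addnS.
  by have := h (n + k)%N; have := dE (n + k)%N; rewrite ler_norml; lra.
have ab m n : u m - d * r ^+ m <= u n + d * r ^+ n.
  have := incr m n; have := decr n m; rewrite addnC.
  by have := d0 (m + n)%N; lra.
pose A := range (fun n => u n - d * r ^+ n).
have A0 : A !=set0 by exists (u 0%N - d * r ^+ 0), 0%N.
have Ab n : ubound A (u n + d * r ^+ n) by move=> _ [m _ <-].
exists (sup A) => n; rewrite -/d distrC ler_distl; apply/andP; split.
  have : u n - d * r ^+ n <= sup A by apply: ub_le_sup; [exists (u 0%N + d * r ^+ 0)|exists n].
  lra.
have : sup A <= u n + d * r ^+ n by apply: ge_sup.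
lra.
Qed.

(** * Hoelder bounds and Hoelder spaces *)

(** Working with an explicit constant H, instead of the extended real
    seminorm, keeps all estimates in R. *)
Definition holder_with {R : realType} (k H : R) (f : R -> R) : Prop :=
  forall s t : R, 0 <= s -> s <= t -> t <= 1 -> `|f t - f s| <= H * (t - s) `^ k.

Lemma holder_with_dist (R : realType) (k H : R) (f : R -> R) (s t : R) : holder_with k H f ->
  0 <= s <= 1 -> 0 <= t <= 1 -> `|f t - f s| <= H * `|t - s| `^ k.
Proof.
move=> hf s01 t01; have [st|ts] := leP s t.
  by rewrite [X in X `^ _]ger0_norm ?subr_ge0//; apply: hf; lra.
by rewrite distrC (distrC t) [X in X `^ _]gtr0_norm ?subr_gt0//; apply: hf; lra.
Qed.

Lemma holder_with_weaken (R : realType) (k l H : R) (f : R -> R) :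
  0 < k -> k <= l -> 0 <= H -> holder_with l H f -> holder_with k H f.
Proof.
move=> k0 kl H0 hf s t s0 st t1; apply: (le_trans (hf _ _ s0 st t1)).
by rewrite ler_wpM2l// ler_powRr//; lra.
Qed.

Lemma holder_with_le (R : realType) (k H H' : R) (f : R -> R) :
  H <= H' -> holder_with k H f -> holder_with k H' f.
Proof.
move=> HH hf s t s0 st t1; apply: (le_trans (hf _ _ s0 st t1)).
by rewrite ler_wpM2r ?powR_ge0.
Qed.

Lemma holder_with_continuous (R : realType) (k H : R) (f : R -> R) :
  0 < k -> holder_with k H f -> {within `[0, 1], continuous f}.
Proof.
move=> k0 hf; apply/subspace_continuousP => t /=; rewrite in_itv/= => t01.
apply/cvgrPdist_lt => e e0.
have H1 : 0 < `|H| + 1 by rewrite ltr_wpDl.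
pose d := (e / (`|H| + 1)) `^ k^-1.
have d0 : 0 < d by rewrite powR_gt0// divr_gt0.
apply/nbhs_ballP; exists d => //= s; rewrite /ball/= => ts; rewrite in_itv/= => s01.
rewrite distrC in ts; rewrite distrC.
apply: (le_lt_trans (holder_with_dist hf t01 s01)).
have : `|s - t| `^ k <= e / (`|H| + 1).
  have -> : e / (`|H| + 1) = d `^ k.
    by rewrite /d -powRrM mulVf ?gt_eqF// powRr1// ltW// divr_gt0.
  by apply: ler_powRl => //; exact: ltW.
rewrite ler_pdivlMr// => h.
have p0 := powR_ge0 `|s - t| k.
have [p00|p1] := eqVneq (`|s - t| `^ k) 0; first by rewrite p00 mulr0.
have pp : 0 < `|s - t| `^ k by rewrite lt_neqAle eq_sym p1.
apply: lt_le_trans h; rewrite mulrC ltr_pM2l//.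
by apply: le_lt_trans (ler_norm _) _; lra.
Qed.

Lemma holder_space_with (R : realType) (k : R) (f : R -> R) :
  holder_space k f -> exists2 H, 0 <= H & holder_with k H f.
Proof.
move=> [_]; rewrite /holder_norm => fin.
have s0 : (0 <= supnorm `[0%R, 1%R] f)%E.
  apply: (@le_trans _ _ (`|f 0|)%:E); first by rewrite lee_fin.
  by apply: ereal_sup_ubound; exists 0 => //=; rewrite in_itv/= lexx ler01.
have h0 : (0 <= holder_seminorm k f)%E.
  apply: (@le_trans _ _ (`|f 1 - f 0| / `|1 - 0| `^ k)%:E).
    by rewrite lee_fin divr_ge0 ?powR_ge0.
  by apply: ereal_sup_ubound; exists 0, 1; split.
have hfin : (holder_seminorm k f < +oo)%E.
  by apply: le_lt_trans fin; rewrite leeDr.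
exists (fine (holder_seminorm k f)); first exact: fine_ge0.
move=> s t sge; rewrite le_eqVlt => /predU1P[<-|st] t1.
  by rewrite !subrr normr0 mulr_ge0 ?powR_ge0 ?fine_ge0.
have ts : 0 < t - s by rewrite subr_gt0.
rewrite -ler_pdivrMr ?powR_gt0// -lee_fin fineK ?ge0_fin_numE//.
apply: ereal_sup_ubound; exists s, t; split=> //.
by rewrite (gtr0_norm ts).
Qed.

Lemma holder_with_holder_norm (R : realType) (k A H : R) (f : R -> R) : holder_with k H f ->
  (forall t, 0 <= t <= 1 -> `|f t| <= A) -> (holder_norm k f <= (A + H)%:E)%E.
Proof.
move=> hf fA; rewrite EFinD; apply: leeD.
  apply: ge_ereal_sup => _ [t /= + <-]; rewrite in_itv/= lee_fin; exact: fA.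
apply: ge_ereal_sup => _ [s [t [s0 st t1 ->]]].
have ts : 0 < t - s by rewrite subr_gt0.
rewrite lee_fin (gtr0_norm ts) ler_pdivrMr ?powR_gt0//; apply: hf => //; exact: ltW.
Qed.

Lemma holder_with_holder_space (R : realType) (k A H : R) (f : R -> R) : 0 < k ->
  holder_with k H f -> (forall t, 0 <= t <= 1 -> `|f t| <= A) -> holder_space k f.
Proof.
move=> k0 hf fA; split; first exact: holder_with_continuous hf.
by apply: le_lt_trans (holder_with_holder_norm hf fA) _; rewrite ltry.
Qed.

(** For functions null at 0 the seminorm dominates the supremum, which is why it
    is the only norm used below. *)
Lemma holder_with_normr_le (R : realType) (k H : R) (f : R -> R) (t : R) : 0 < k ->
  holder_with k H f -> f 0 = 0 -> 0 <= t <= 1 -> `|f t| <= H.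
Proof.
move=> k0 hf f0 t01.
have H0 : 0 <= H.
  have := le_trans (normr_ge0 _) (hf 0 1 (lexx 0) ler01 (lexx 1)).
  by rewrite subr0 powR1 mulr1.
have /andP[t0 t1] := t01; have := hf 0 t (lexx 0) t0 t1.
rewrite f0 !subr0 => /le_trans; apply.
by rewrite -[leRHS]mulr1 ler_wpM2l// powR_le1// ltW.
Qed.

Lemma holder_with_eq (R : realType) (k H : R) (f g : R -> R) :
  (forall t, 0 <= t <= 1 -> f t = g t) -> holder_with k H f -> holder_with k H g.
Proof. by move=> fg hf s t s0 st t1; rewrite -!fg ?hf//; lra. Qed.

Lemma holder_with_sub (R : realType) (k H1 H2 : R) (f g : R -> R) :
  holder_with k H1 f -> holder_with k H2 g -> holder_with k (H1 + H2) (f \- g).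
Proof.
move=> hf hg s t s0 st t1 /=; have := hf s t s0 st t1; have := hg s t s0 st t1.
rewrite mulrDl !ler_norml; lra.
Qed.

Lemma le_supnorm (R : realType) (A : set R) (f : R -> R) (c t : R) :
  (supnorm A f <= c%:E)%E -> A t -> `|f t| <= c.
Proof.
move=> h At; rewrite -lee_fin; apply: le_trans h.
by apply: ereal_sup_ubound; exists t.
Qed.

(** * The Young integral *)

(** The solution C of C = 2 * 2^-1 `^ th * C + 2, the balance met in the
    induction of left_sum_bound. *)
Definition young_cst {R : realType} (th : R) : R := 2 / (1 - 2 * 2^-1 `^ th).

Lemma double_half_powR_lt1 (R : realType) (th : R) :
  1 < th -> 2 * 2^-1 `^ th < 1 :> R.
Proof.
move=> th1; have -> : th = 1 + (th - 1) by lra.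
rewrite powR_splitD ?subr_gt0 ?ltr01// powRr1 ?invr_ge0// mulrA divff ?mul1r//.
by rewrite half_powR_lt1// subr_gt0.
Qed.

Lemma young_cst_ge0 (R : realType) (th : R) : 1 < th -> 0 <= young_cst th.
Proof.
by move=> /double_half_powR_lt1 h; rewrite /young_cst divr_ge0// subr_ge0 ltW.
Qed.

Section davie.
Context {R : realType} (gam kap X H : R) (x g : R -> R).
Context (gam0 : 0 < gam) (kap0 : 0 < kap) (th1 : 1 < gam + kap).
Context (X0 : 0 <= X) (H0 : 0 <= H) (hx : holder_with gam X x) (hg : holder_with kap H g).
Let th := gam + kap.

Lemma young_increment_product a b c d w :
  0 <= a -> a <= b -> b <= 1 -> 0 <= c -> c <= d -> d <= 1 ->
  b - a <= w -> d - c <= w ->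
  `|(g b - g a) * (x d - x c)| <= H * X * w `^ th.
Proof.
move=> a0 ab b1 c0 cd d1 baw dcw; rewrite normrM.
have -> : H * X * w `^ th = (H * w `^ kap) * (X * w `^ gam).
  by rewrite /th powR_splitD//; ring.
apply: ler_pM => //.
  apply: (le_trans (hg _ _ _)) => //.
  by rewrite ler_wpM2l// ler_powRl ?subr_ge0// ltW.
apply: (le_trans (hx _ _ _)) => //.
by rewrite ler_wpM2l// ler_powRl ?subr_ge0// ltW.
Qed.

(** Strong induction on the number n of intervals.  Cutting after the last
    point of the first half of [t_j, t_(j+n)] isolates one interval, whose left
    sum is exact, between two blocks of at most half the length each.  The two
    blocks contribute 2 * 2^-1 `^ th times the bound, which is less than the
    bound because th > 1, and regrouping the left values costs two products of
    increments. *)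
Lemma left_sum_bound (t : nat -> R) :
  {homo t : i j / (i <= j)%N >-> i <= j} -> (forall i, 0 <= t i <= 1) ->
  forall n j, `|\sum_(j <= i < j + n) g (t i) * (x (t i.+1) - x (t i)) -
      g (t j) * (x (t (j + n)%N) - x (t j))| <=
    young_cst th * H * X * (t (j + n)%N - t j) `^ th.
Proof.
have hC : young_cst th * (1 - 2 * 2^-1 `^ th) = 2.
  by rewrite /young_cst divfK// subr_eq0 eq_sym lt_eqF// double_half_powR_lt1.
move: (young_cst th) (young_cst_ge0 th1) hC => C C0 hC.
move=> tm t01 n; elim/ltn_ind: n => n IH j.
have RHS0 : 0 <= C * H * X * (t (j + n)%N - t j) `^ th.
  by rewrite !mulr_ge0// powR_ge0.
have [n0|n0] := posnP n.
  by move: RHS0; rewrite n0 addn0 big_geq// !subrr mulr0 subrr normr0.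
set w := t (j + n)%N - t j.
have w0 : 0 <= w by rewrite subr_ge0 tm// leq_addr.
pose P m := (m < n)%N && (t (j + m)%N - t j <= w / 2).
have exP : exists m, P m by exists 0%N; rewrite /P n0 addn0 subrr divr_ge0.
have ubP m : P m -> (m <= n)%N by case/andP => /ltnW.
(* t (j + m) is the last point of the first half; maximality of m bounds the
   distance from the next point to the end. *)
case: (ex_maxnP exP ubP) => m /andP[mn mw] mmax.
have mw2 : t (j + n)%N - t (j + m).+1 <= w / 2.
  have [e|ne] := eqVneq m.+1 n.
    by rewrite -addnS e subrr divr_ge0.
  have /negP : ~~ P m.+1 by apply/negP => /mmax; rewrite ltnn.
  rewrite /P ltn_neqAle ne mn/= => /negP; rewrite -ltNge /w addnS; lra.
have nE : (n = m + (1 + (n - m.+1)))%N by rewrite addnA addn1 subnKC.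
have jnE : (j + n = (j + m).+1 + (n - m.+1))%N by rewrite {1}nE; ring.
have i1 := IH m mn j.
have i2 := IH (n - m.+1)%N (ltac:(by rewrite ltn_subrL n0)) (j + m).+1.
rewrite -jnE in i2.
rewrite (@big_cat_nat _ _ _ (j + m)%N)/= ?leq_addr ?leq_add2l ?(ltnW mn)//.
rewrite (@big_ltn _ _ _ (j + m)%N) ?ltn_add2l//.
move: i1 i2; set S1 := \sum_(_ <= _ < _) _; set S2 := \sum_(_ <= _ < _) _.
have ja : t j <= t (j + m)%N by rewrite tm// leq_addr.
have ab : t (j + m)%N <= t (j + m).+1 by rewrite tm.
have be : t (j + m).+1 <= t (j + n)%N by rewrite tm// jnE leq_addr.
have /andP[j0 _] := t01 j; have /andP[_ e1] := t01 (j + n)%N.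
have b1 : t (j + m).+1 <= 1 by lra.
clear P exP ubP mmax IH nE jnE n0 mn.
have pr := fun b c d w => @young_increment_product (t j) b c d w j0.
have := pr _ (t (j + m)%N) (t (j + m).+1) w ja.
have := pr _ (t (j + m).+1) (t (j + n)%N) w (le_trans ja ab) b1.
clear pr; move: (t j) (t (j + m)%N) (t (j + m).+1) (t (j + n)%N) @w
  ja ab be mw mw2 w0 j0 b1 e1 {RHS0} => a b c e w ja ab be mw mw2 w0 j0 b1 e1.
move=> /(_ ltac:(lra) be e1 ltac:(rewrite /w; lra) ltac:(rewrite /w; lra)) p2.
move=> /(_ ltac:(lra) ltac:(lra) ab b1 ltac:(rewrite /w; lra) ltac:(rewrite /w; lra)) p1 i1 i2.
have wh : (w / 2) `^ th = w `^ th * 2^-1 `^ th by rewrite powRM ?invr_ge0.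
have th0 : 0 <= th by rewrite ltW// addr_gt0.
have CHX : 0 <= C * H * X by rewrite !mulr_ge0.
have k1 : C * H * X * (b - a) `^ th <= C * H * X * (w / 2) `^ th.
  by rewrite ler_wpM2l// ler_powRl// subr_ge0.
have k2 : C * H * X * (e - c) `^ th <= C * H * X * (w / 2) `^ th.
  by rewrite ler_wpM2l// ler_powRl// subr_ge0.
have CE : C * H * X * w `^ th =
    2 * (C * H * X * (w / 2) `^ th) + 2 * (H * X * w `^ th).
  have -> : C * H * X * w `^ th =
     C * (1 - 2 * 2^-1 `^ th) * (H * X * w `^ th)
       + 2 * 2^-1 `^ th * C * H * X * w `^ th by ring.
  by rewrite hC wh; ring.
rewrite CE.
have -> : S1 + (g b * (x c - x b) + S2) - g a * (x e - x a) =
  (S1 - g a * (x b - x a)) + (S2 - g c * (x e - x c)) +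
  (g b - g a) * (x c - x b) + (g c - g a) * (x e - x c) by ring.
move: i1 i2 p1 p2; rewrite !ler_norml => i1 i2 p1 p2; lra.
Qed.
End davie.

Lemma exists_fine_partition (R : realType) (a b d : R) : a < b -> 0 < d ->
  exists2 s, itv_partition a b s &
    forall i, (i < size s)%N ->
      nth b (a :: s) i <= nth b (a :: s) i.+1 /\
      nth b (a :: s) i.+1 - nth b (a :: s) i < d.
Proof.
move=> ab d0.
have [n hn] : exists n : nat, b - a <= d / 2 * n%:R.
  exists (Num.truncn ((b - a) / (d / 2))).+1; rewrite mulrC -ler_pdivrMr ?divr_gt0//.
  by rewrite ltW// truncnS_gt.
elim: n a ab hn => [|n IH] a ab hn; first by rewrite mulr0 in hn; lra.
have [h|h] := leP (b - a) (d / 2).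
  exists [:: b]; first exact: itv_partition1.
  by case=> //= _; split; lra.
have cb : a + d / 2 < b by lra.
have [|s ps hs] := IH _ cb; first by move: hn; rewrite -[n.+1%:R]natr1; lra.
exists ((a + d / 2) :: s).
  have ac : a < a + d / 2 by lra.
  exact: (itv_partition_cat (itv_partition1 ac) ps).
case=> [_|i /= ilt]; first by split=> /=; lra.
exact: hs.
Qed.

(** Both limits are compared on one fine partition, tagged by left endpoints. *)
Lemma is_young_integral_unique (R : realType) (g x : R -> R) (a b I J : R) :
  a <= b -> is_young_integral g x a b I -> is_young_integral g x a b J -> I = J.
Proof.
move=> ab hI hJ; apply/eqP; rewrite -subr_eq0 -normr_le0 leNgt; apply/negP => e0.
have e2 : 0 < `|I - J| / 2 by rewrite divr_gt0.
have [d d0 hd] := hI _ e2; have [d' d'0 hd'] := hJ _ e2.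
have [s ps hs] : exists2 s, itv_partition a b s &
    forall i, (i < size s)%N ->
      nth b (a :: s) i <= nth b (a :: s) i.+1 /\
      nth b (a :: s) i.+1 - nth b (a :: s) i < Num.min d d'.
  move: ab; rewrite le_eqVlt => /predU1P[<-|ab].
    by exists [::].
  by apply: exists_fine_partition => //; rewrite lt_min d0.
have tagged i : (i < size s)%N -> forall r, Num.min d d' <= r ->
    nth b (a :: s) i.+1 - nth b (a :: s) i < r /\
    nth b (a :: s) i <= nth b (a :: s) i <= nth b (a :: s) i.+1.
  by move=> /hs[h1 h2] r dr; rewrite lexx h1 (lt_le_trans h2).
have h1 := hd _ _ ps (fun i si => tagged i si d ltac:(by rewrite ge_min lexx)).
have h2 := hd' _ _ ps (fun i si => tagged i si d' ltac:(by rewrite ge_min lexx orbT)).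
move: h1 h2; set S := \sum_(_ <= _ < _) _ => h1 h2.
have : `|I - J| <= `|S - I| + `|S - J|.
  by rewrite (distrC S I) (le_trans _ (ler_normD _ _))// addrA subrK.
lra.
Qed.

Lemma young_integralE (R : realType) (g x : R -> R) (a b I : R) :
  a <= b -> is_young_integral g x a b I -> young_integral g x a b = I.
Proof.
move=> ab hI; apply: get_unique => // J hJ.
exact: (is_young_integral_unique ab hJ hI).
Qed.

Lemma is_young_integralB (R : realType) (g1 g2 x : R -> R) (a b I1 I2 : R) :
  is_young_integral g1 x a b I1 -> is_young_integral g2 x a b I2 ->
  is_young_integral (g1 \- g2) x a b (I1 - I2).
Proof.
move=> h1 h2 e e0; have e2 : 0 < e / 2 by lra.
have [d1 d10 hd1] := h1 _ e2; have [d2 d20 hd2] := h2 _ e2.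
exists (Num.min d1 d2); first by rewrite lt_min d10.
move=> s tau ps t ht.
have {}hd1 := hd1 s tau ps; have {}hd2 := hd2 s tau ps.
have {}hd1 := hd1 (ltac:(by move=> i /ht[]; rewrite lt_min => /andP[])).
have {}hd2 := hd2 (ltac:(by move=> i /ht[]; rewrite lt_min => /andP[])).
under eq_bigr do rewrite /= mulrBl.
rewrite sumrB; move: hd1 hd2; rewrite -/t !ltr_norml; lra.
Qed.

Section young.
Context {R : realType} (gam kap X H : R) (x g : R -> R).
Context (gam0 : 0 < gam) (kap0 : 0 < kap) (th1 : 1 < gam + kap).
Context (X0 : 0 <= X) (H0 : 0 <= H) (hx : holder_with gam X x) (hg : holder_with kap H g).
Let th := gam + kap.
Let rho : R := 2 * 2^-1 `^ th.

(* q n is the dyadic grid of level n, p n a b the same grid clamped to [a, b].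
   F n t is the left sum over the grid stopped at t; stopping the integrator,
   and not the grid, makes F n b - F n a a left sum over [a, b], so that the
   limit in n is additive in the interval from the start. *)
Let q n i : R := i%:R * 2^-1 ^+ n.
Let p n (a b : R) i := Num.max a (Num.min b (q n i)).
Let F n t := \sum_(0 <= i < 2 ^ n)
  g (q n i) * (x (Num.min (q n i.+1) t) - x (Num.min (q n i) t)).

Let qS n i : q n i.+1 = q n i + 2^-1 ^+ n.
Proof. by rewrite /q -[i.+1%:R]natr1 mulrDl mul1r. Qed.

Let w_ge0 n : 0 <= 2^-1 ^+ n :> R.
Proof. by rewrite exprn_ge0 ?invr_ge0. Qed.

Let q_ge0 n i : 0 <= q n i.
Proof. by rewrite mulr_ge0. Qed.

Let q_max n : q n (2 ^ n)%N = 1.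
Proof. by rewrite /q natrX -exprMn mulfV ?expr1n. Qed.

Let q_mono n : {homo q n : i j / (i <= j)%N >-> i <= j}.
Proof. by move=> i j ij; rewrite ler_wpM2r ?ler_nat. Qed.

Let q_double n i : q n.+1 (i.*2) = q n i.
Proof.
by rewrite /q -muln2 natrM exprS -mulrA (mulrA 2) mulfV ?mul1r.
Qed.

Let sum_w n : \sum_(0 <= i < 2 ^ n) H * X * (2^-1 ^+ n) `^ th = H * X * rho ^+ n.
Proof.
rewrite sumr_const_nat subn0 -[LHS]mulr_natl natrX powR_exprn ?invr_ge0//.
by rewrite /rho exprMn; ring.
Qed.

Let sum_double (f : nat -> R) n :
  \sum_(0 <= i < n.*2) f i = \sum_(0 <= i < n) (f i.*2 + f i.*2.+1).
Proof.
elim: n => [|n IH]; first by rewrite !big_geq.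
by rewrite doubleS !big_nat_recr//= IH -addrA.
Qed.

(* Refining the grid changes each of the 2 ^ n terms by a product of increments
   over intervals of length at most 2 ^- n, hence the ratio
   rho = 2 * 2^-1 `^ th < 1. *)
Let F_step n t : 0 <= t -> t <= 1 -> `|F n.+1 t - F n t| <= H * X * rho ^+ n.
Proof.
move=> t0 t1; rewrite /F expnS mul2n sum_double -sumrB -sum_w.
apply: (le_trans (ler_norm_sum _ _ _)); apply: ler_sum_nat => i /andP[_ i2].
set Q := q n.+1 i.*2.+1.
rewrite -doubleS !q_double.
have Q1 : q n i.+1 <= 1 by rewrite -(q_max n) q_mono.
have QE : Q = q n i + 2^-1 ^+ n.+1 by rewrite /Q qS q_double.
have wE : 2^-1 ^+ n = 2 * 2^-1 ^+ n.+1 :> R.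
  by rewrite exprS mulrA mulfV ?mul1r.
have := q_ge0 n i; have := w_ge0 n.+1; have := qS n i => q1 w0 q0.
rewrite [X in `|X|](_ : _ =
    (g Q - g (q n i)) * (x (Num.min (q n i.+1) t) - x (Num.min Q t))); last ring.
apply: (young_increment_product gam0 kap0 X0 H0 hx hg);
  case: (leP Q t) => ?; case: (leP (q n i.+1) t) => ?; lra.
Qed.

Let p_clamp n a b i : a <= b ->
  x (Num.min (q n i) b) - x (Num.min (q n i) a) = x (p n a b i) - x a.
Proof.
move=> ab; rewrite /p; case: (leP b (q n i)) => h1.
  by rewrite (max_r ab) (min_r (le_trans ab h1)).
by case: (leP (q n i) a) => h2; rewrite ?subrr.
Qed.

(* F n b - F n a differs from the left sum over the clamped grid only by the
   value of g on the cell that contains a, an error that vanishes with n. *)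
Let F_dyadic n a b : 0 <= a -> a <= b -> b <= 1 ->
  `|F n b - F n a - g a * (x b - x a)| <=
     young_cst th * H * X * (b - a) `^ th + H * X * rho ^+ n.
Proof.
move=> a0 ab b1.
have pm : {homo p n a b : i j / (i <= j)%N >-> i <= j}.
  move=> i j ij; have := q_mono n ij; rewrite /p => qij.
  by apply: le_max2 => //; apply: le_min2.
have p01 i : 0 <= p n a b i <= 1.
  by rewrite /p le_max a0/= ge_max ge_min b1/= andbT; lra.
have p0 : p n a b 0 = a.
  by rewrite /p /q mul0r; case: (leP b 0) => h; case: leP; lra.
have pN : p n a b (2 ^ n) = b.
  by rewrite /p q_max; case: (leP b 1) => h; case: leP; lra.
have FE : F n b - F n a =
    \sum_(0 <= i < 2 ^ n) g (q n i) * (x (p n a b i.+1) - x (p n a b i)).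
  rewrite /F -sumrB; apply: eq_bigr => i _; rewrite -mulrBr; congr (_ * _).
  have := p_clamp n i ab; have := p_clamp n i.+1 ab; lra.
have := left_sum_bound gam0 kap0 th1 X0 H0 hx hg pm p01 (2 ^ n) 0.
rewrite !add0n p0 pN => B1.
have B2 : `|F n b - F n a -
     \sum_(0 <= i < 2 ^ n) g (p n a b i) * (x (p n a b i.+1) - x (p n a b i))|
      <= H * X * rho ^+ n.
  rewrite FE -sumrB -sum_w.
  apply: (le_trans (ler_norm_sum _ _ _)); apply: ler_sum_nat => i /andP[_ i2].
  rewrite -mulrBl.
  (* cells beyond b, then cells before a: clamping makes the increment null *)
  have [qb|bq] := leP b (q n i).
    have -> : p n a b i.+1 = p n a b i.
      by rewrite /p !min_l// (le_trans qb)// q_mono.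
    by rewrite subrr mulr0 normr0 mulr_ge0 ?powR_ge0// mulr_ge0.
  have [qa|aq] := leP (q n i.+1) a.
    have pa j : q n j <= a -> p n a b j = a.
      by move=> h; rewrite /p max_l// ge_min h orbT.
    rewrite !pa//; last by rewrite (le_trans _ qa)// q_mono.
    by rewrite subrr mulr0 normr0 mulr_ge0 ?powR_ge0// mulr_ge0.
  rewrite -normrN -mulNr opprB.
  have /andP[? ?] := p01 i; have /andP[? ?] := p01 i.+1.
  have := q_ge0 n i; have := qS n i; have := w_ge0 n => ? ? ?.
  have pE : p n a b i = Num.max a (q n i) by rewrite /p (min_r (ltW bq)).
  have pSE : p n a b i.+1 = Num.min b (q n i.+1).
    by rewrite /p max_r// le_min ab ltW.
  have pq : q n i <= p n a b i by rewrite pE le_max lexx orbT.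
  have pq' : p n a b i - q n i <= 2^-1 ^+ n.
    by rewrite pE; case: (leP a (q n i)); lra.
  have pp : p n a b i <= p n a b i.+1 by exact: pm.
  apply: (young_increment_product gam0 kap0 X0 H0 hx hg) => //.
  by rewrite pE pSE; case: (leP b (q n i.+1)); case: (leP a (q n i)); lra.
move: B1 B2; rewrite !ler_norml; lra.
Qed.

(** The limit of the dyadic sums, which is additive by construction and inherits
    the estimate of left_sum_bound. *)
Lemma sewing : exists I : R -> R, forall a b, 0 <= a -> a <= b -> b <= 1 ->
  `|I b - I a - g a * (x b - x a)| <= young_cst th * H * X * (b - a) `^ th.
Proof.
have r0 : 0 <= rho by rewrite mulr_ge0 ?powR_ge0.
have r1 : rho < 1 by exact: double_half_powR_lt1.
have /choice[I hI] : forall t, exists l, 0 <= t <= 1 ->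
    forall n, `|F n t - l| <= H * X / (1 - rho) * rho ^+ n.
  move=> t; have [/andP[t0 t1]|/negP nt] := boolP (0 <= t <= 1); last by exists 0.
  have [l hl] := geometric_limit r0 r1 (fun n => F_step n t0 t1).
  by exists l.
exists I => a b a0 ab b1.
apply: (@ler_geometric _ rho (H * X + 2 * (H * X / (1 - rho)))) => // n.
have a01 : 0 <= a <= 1 by lra.
have b01 : 0 <= b <= 1 by lra.
have := F_dyadic n a0 ab b1; have := hI a a01 n; have := hI b b01 n.
rewrite !ler_norml; lra.
Qed.

(** Against any tagged partition of mesh d, the error on each interval is
    O(|interval|^th), so the total error is at most
    K d^(th - 1) (b - a), which tends to 0 because th > 1. *)
Lemma is_young_integral_of_sewing (I : R -> R) (c : R) : 0 <= c ->
  (forall a b, 0 <= a -> a <= b -> b <= 1 ->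
    `|I b - I a - g a * (x b - x a)| <= c * (b - a) `^ th) ->
  forall a b, 0 <= a -> a <= b -> b <= 1 -> is_young_integral g x a b (I b - I a).
Proof.
move=> c0 hI a b a0 ab b1 e e0.
pose K := c + H * X.
have K0 : 0 <= K by rewrite addr_ge0// mulr_ge0.
have th0 : 0 < th - 1 by rewrite subr_gt0.
have eK : 0 < e / (K + 1) by rewrite divr_gt0// ltr_wpDl.
(* the mesh d is chosen so that K d^(th - 1) = K e / (K + 1) < e *)
exists ((e / (K + 1)) `^ (th - 1)^-1); first exact: powR_gt0.
set d := _ `^ _ => s tau ps t ht.
have dE : d `^ (th - 1) = e / (K + 1).
  by rewrite /d -powRrM mulVf ?gt_eqF// powRr1// ltW.
have tN : t (size s) = b by exact: itv_partition_nth_size.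
have telI : I b - I a = \sum_(0 <= i < size s) (I (t i.+1) - I (t i)).
  by rewrite (telescope_sumr (fun i => I (t i)))// tN.
have telt : b - a = \sum_(0 <= i < size s) (t i.+1 - t i).
  by rewrite (telescope_sumr t)// tN.
rewrite telI -sumrB.
apply: (le_lt_trans (ler_norm_sum _ _ _)).
apply: (@le_lt_trans _ _ (\sum_(0 <= i < size s) K * (e / (K + 1)) * (t i.+1 - t i))).
  apply: ler_sum_nat => i /andP[_ si].
  have [dlt /andP[t1 t2]] := ht i si.
  have ta : a <= t i by apply: itv_partition_nth_ge => //; apply: ltnW.
  have tb : t i.+1 <= b by apply: itv_partition_nth_le.
  have dd : (t i.+1 - t i) `^ th <= (e / (K + 1)) * (t i.+1 - t i).
    have -> : th = (th - 1) + 1 by lra.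
    rewrite powR_splitD// powRr1; last lra.
    rewrite ler_wpM2r//; first lra.
    by rewrite -dE ler_powRl//; lra.
  have A1 := hI (t i) (t i.+1) ltac:(lra) ltac:(lra) ltac:(lra).
  have A2 : `|(g (tau i) - g (t i)) * (x (t i.+1) - x (t i))|
       <= H * X * (t i.+1 - t i) `^ th.
    by apply: (young_increment_product gam0 kap0 X0 H0 hx hg); lra.
  have A3 : K * (t i.+1 - t i) `^ th <= K * (e / (K + 1)) * (t i.+1 - t i).
    by rewrite -mulrA ler_wpM2l.
  rewrite [X in `|X|](_ : _ = (g (tau i) - g (t i)) * (x (t i.+1) - x (t i))
    - (I (t i.+1) - I (t i) - g (t i) * (x (t i.+1) - x (t i)))); last ring.
  apply: (le_trans (ler_normB _ _)); rewrite /K mulrDl in A3 *; lra.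
rewrite -big_distrr/= -telt.
apply: (@le_lt_trans _ _ (K * (e / (K + 1)))).
  apply: ler_piMr; last lra.
  by apply: mulr_ge0 => //; apply: ltW.
have -> : K * (e / (K + 1)) = e - e / (K + 1) by field; lra.
lra.
Qed.

Lemma young_integral_exists : exists I : R -> R,
  forall a b, 0 <= a -> a <= b -> b <= 1 ->
  is_young_integral g x a b (I b - I a) /\
  `|I b - I a - g a * (x b - x a)| <= young_cst th * H * X * (b - a) `^ th.
Proof.
have [I hI] := sewing; exists I => a b a0 ab b1; split; last exact: hI.
have C0 := young_cst_ge0 th1.
by apply: (is_young_integral_of_sewing _ hI) => //; apply: mulr_ge0 => //; apply: mulr_ge0.
Qed.

End young.

(** * The Garsia-Rodemich-Rumsey inequality *)

(** The integral of a nonnegative function is a supremum over the simple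
    functions below it, hence it is monotone even where measurability is
    unknown.  This is what lets the outer integral of a double integral be
    handled without Fubini's theorem. *)
Lemma le_integral_restrict d (T : measurableType d) (R : realType)
    (mu : {measure set T -> \bar R}) (A B : set T) (f g : T -> \bar R) :
  (forall x, A x -> (0 <= f x)%E) -> (forall x, B x -> (0 <= g x)%E) ->
  (forall x, ((f \_ A) x <= (g \_ B) x)%E) ->
  (\int[mu]_(x in A) f x <= \int[mu]_(x in B) g x)%E.
Proof.
move=> f0 g0 fg; rewrite !ge0_integralE//.
by apply: le_ereal_sup => _ [h hf <-]; exists h => // x; apply: (le_trans (hf x)).
Qed.

(** The factor 2 makes the contradiction strict when the function exceeds the
    stated value everywhere on [c, d]. *)
Lemma exists_le_mean (R : realType) (a : R -> \bar R) (c d B : R) :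
  0 <= c -> c < d -> d <= 1 -> 0 < B -> (forall z, 0 <= z <= 1 -> (0 <= a z)%E) ->
  (\int[lebesgue_measure]_(z in `[0%R, 1%R]) a z <= B%:E)%E ->
  exists2 z, c <= z <= d & (a z <= (2 * B / (d - c))%:E)%E.
Proof.
move=> c0 cd d1 B0 a0 aB; apply: contrapT => /forall2NP nz.
have dc : 0 < d - c by rewrite subr_gt0.
suff : ((2 * B)%:E <= B%:E)%E by rewrite lee_fin; lra.
apply: le_trans aB.
have -> : ((2 * B)%:E = \int[lebesgue_measure]_(z in `[c, d]) (2 * B / (d - c))%:E)%E.
  rewrite integral_cst//= lebesgue_measure_itv/= lte_fin cd -EFinB -EFinM divfK//.
  by rewrite gt_eqF.
apply: le_integral_restrict.
- by move=> z _; rewrite lee_fin divr_ge0 ?mulr_ge0// ltW.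
- by move=> z /=; rewrite in_itv/= => ?; apply: a0.
- move=> z; rewrite !patchE; case: ifPn => [/set_mem/=|_]; last first.
    by case: ifPn => // /set_mem/=; rewrite in_itv; apply: a0.
  rewrite in_itv/= => zcd; rewrite mem_set/=; last by rewrite in_itv/=; lra.
  by have [//|] := nz z; rewrite leNgt => /negP/negPn => /ltW.
Qed.

Section grr.
Context {R : realType} (gam q : R) (f : R -> R).
Context (gam0 : 0 < gam) (q1 : 1 <= q) (cf : {within `[0, 1], continuous f}).

(* D is the integrand of the double integral and a its inner integral; a is
   handled through the monotonicity of the integral alone. *)
Let D z e := `|f z - f e| `^ q / `|z - e| `^ (q * gam + 2).
Let a z := (\int[lebesgue_measure]_(e in `[0%R, 1%R]) (D z e)%:E)%E.

Let D_ge0 z e : 0 <= D z e.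
Proof. by rewrite divr_ge0 ?powR_ge0. Qed.

Let measurable_D z : measurable_fun (`[0%R, 1%R] : set R) (D z).
Proof.
rewrite (_ : D z = (fun e => `|f z - f e| `^ q * `|z - e| `^ - (q * gam + 2))).
  2: by apply/funext => e; rewrite powRN.
have mf : measurable_fun (`[0%R, 1%R] : set R) f by apply: subspace_continuous_measurable_fun.
apply: measurable_funM => /=.
  apply: (measurableT_comp (measurable_powR _)).
  apply: measurableT_comp => //.
  by apply: measurable_funB.
apply: (measurableT_comp (measurable_powR _)).
apply: measurableT_comp => //.
by apply: measurable_funB.
Qed.

Let mD z : measurable_fun (`[0%R, 1%R] : set R) (fun e => (D z e)%:E : \bar R).
Proof. by apply/measurable_EFinP. Qed.

Let a_ge0 z : (0 <= a z)%E.
Proof. by apply: integral_ge0 => e _; rewrite lee_fin. Qed.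

(* The exponent q * gam + 2 is what turns a bound on D at scale l, of order
   l ^- 2, into a Hoelder bound of exponent gam. *)
Let D_dist (z e A l : R) : 0 <= A -> 0 < l -> `|z - e| <= l -> D z e <= A / l ^+ 2 ->
  `|f z - f e| <= A `^ q^-1 * l `^ gam.
Proof.
move=> A0 l0 zel DA.
have q0 : 0 < q by exact: lt_le_trans ltr01 q1.
have [->|ze] := eqVneq z e.
  by rewrite subrr normr0 mulr_ge0 ?powR_ge0.
have nze : 0 < `|z - e| by rewrite normr_gt0 subr_eq0.
have -> : `|f z - f e| = (`|f z - f e| `^ q) `^ q^-1.
  by rewrite -powRrM mulfV ?gt_eqF// powRr1.
have -> : l `^ gam = (l `^ (q * gam)) `^ q^-1.
  by rewrite -powRrM mulrAC mulfV ?gt_eqF// mul1r.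
rewrite -powRM ?powR_ge0//; apply: ler_powRl; rewrite ?powR_ge0 ?invr_ge0 ?(ltW q0)//.
have -> : `|f z - f e| `^ q = D z e * `|z - e| `^ (q * gam + 2).
  by rewrite /D divfK// gt_eqF// powR_gt0.
have -> : A * l `^ (q * gam) = A / l ^+ 2 * l `^ (q * gam + 2).
  rewrite powR_splitD ?mulr_gt0// powR_mulrn ?(ltW l0)//.
  by field; rewrite gt_eqF.
by apply: ler_pM; rewrite ?powR_ge0// ler_powRl// addr_ge0// mulr_ge0// ltW.
Qed.

(* Two points z and z' of small inner integral, at scales l and l / 2, are
   compared through a common e: exists_le_mean applied to D z + D z' yields an e
   close to both in the sense of D.  The constant is 48 = 2 * 24, where
   24 = 2 * 6 * 2 and 6 = 2 + 4 adds up the two bounds on a. *)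
Let link (z z' c l B : R) : 0 < B -> 0 < l ->
  0 <= c -> c + l / 2 <= 1 -> c <= z' <= c + l / 2 ->
  (forall e, c <= e <= c + l / 2 -> `|z - e| <= l) ->
  (a z <= (2 * B / l)%:E)%E -> (a z' <= (2 * B / (l / 2))%:E)%E ->
  `|f z' - f z| <= 48 * B `^ q^-1 * l `^ gam.
Proof.
move=> B0 l0 c0 cl z'J zJ az az'.
have [||||e eJ] := @exists_le_mean R (fun e => (D z e)%:E + (D z' e)%:E)%E c (c + l / 2)
  (6 * B / l) c0 _ cl.
- lra.
- by rewrite divr_gt0// mulr_gt0.
- by move=> e _; rewrite -EFinD lee_fin addr_ge0.
- rewrite ge0_integralD//; try exact: mD.
  + rewrite (le_trans (leeD az az'))// -EFinD lee_fin le_eqVlt; apply/orP; left.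
    by apply/eqP; field; rewrite gt_eqF.
  + by move=> e _; rewrite lee_fin.
  + by move=> e _; rewrite lee_fin.
rewrite -EFinD lee_fin => De.
have De' : D z e + D z' e <= 24 * B / l ^+ 2.
  apply: (le_trans De); rewrite le_eqVlt; apply/orP; left; apply/eqP.
  by field; rewrite gt_eqF.
have A0 : 0 <= 24 * B by rewrite mulr_ge0// ltW.
have d1 := @D_dist z e (24 * B) l A0 l0 (zJ e eJ) ltac:(have := D_ge0 z' e; lra).
have d2 := @D_dist z' e (24 * B) l A0 l0 ltac:(rewrite ler_norml; lra)
  ltac:(have := D_ge0 z e; lra).
have k : (24 * B) `^ q^-1 <= 24 * B `^ q^-1.
  rewrite powRM// ?(ltW B0)// ler_wpM2r ?powR_ge0//.
  rewrite -[leRHS]powRr1//; apply: ler_powR; first by rewrite ler1n.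
  by rewrite invf_le1 ?(lt_le_trans ltr01 q1).
have k2 := ler_wpM2r (powR_ge0 l gam) k.
rewrite (_ : f z' - f z = (f z' - f e) - (f z - f e)); last ring.
apply: (le_trans (ler_normB _ _)); lra.
Qed.

(** Two chains, one for each endpoint, of links of total length
    48 / (1 - 2^-1 `^ gam). *)
Definition grr_cst : R := 96 / (1 - 2^-1 `^ gam).

(* Intervals [c n, c n + l / 2 ^ n] shrink to e; a point of small inner integral
   is picked in each, and consecutive ones are linked.  The a priori Hoelder
   constant X identifies the limit of the chain as f e. *)
Let chain (X : R) (c : nat -> R) (l B z0 e : R) : holder_with gam X f -> 0 < B -> 0 < l ->
  (forall n, 0 <= c n) -> (forall n, c n + l / 2 ^+ n <= 1) ->
  (forall n, c n <= c n.+1 /\ c n.+1 + l / 2 ^+ n.+1 <= c n + l / 2 ^+ n) ->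
  (forall n, c n <= e <= c n + l / 2 ^+ n) ->
  (\int[lebesgue_measure]_(z in `[0%R, 1%R]) a z <= B%:E)%E ->
  c 0%N <= z0 <= c 0%N + l -> (a z0 <= (2 * B / l)%:E)%E ->
  `|f e - f z0| <= grr_cst / 2 * B `^ q^-1 * l `^ gam.
Proof.
move=> hf B0 l0 c0 c1 cc ce aB z0J az0.
have ln n : 0 < l / 2 ^+ n by rewrite divr_gt0// exprn_gt0.
have lS n : l / 2 ^+ n.+1 = l / 2 ^+ n / 2 by rewrite exprSr invfM mulrA.
(* the first point is imposed, so that the chains of two endpoints can meet *)
pose P n z := [/\ c n <= z <= c n + l / 2 ^+ n,
   (a z <= (2 * B / (l / 2 ^+ n))%:E)%E & n = 0%N -> z = z0].
have /choice[z hz] : forall n, exists z, P n z.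
  case=> [|n]; first by exists z0; split; rewrite // expr0 divr1.
  have [||||||z zJ az] := @exists_le_mean R a (c n.+1) (c n.+1 + l / 2 ^+ n.+1) B.
  - exact: c0.
  - by rewrite ltrDl.
  - exact: c1.
  - exact: B0.
  - by move=> ? _.
  - exact: aB.
  by exists z; split=> //; rewrite (le_trans az)// lee_fin addrC addKr.
have z00 : z 0%N = z0 by case: (hz 0%N) => _ _ ->.
have lnE n : (l / 2 ^+ n) `^ gam = l `^ gam * (2^-1 `^ gam) ^+ n.
  by rewrite -exprVn powRM ?exprn_ge0 ?invr_ge0 ?(ltW l0)// powR_exprn ?invr_ge0.
have r0 : 0 <= (2^-1 : R) `^ gam by exact: powR_ge0.
have r1 := half_powR_lt1 gam0.
have step n : `|f (z n.+1) - f (z n)| <=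
    48 * B `^ q^-1 * l `^ gam * (2^-1 `^ gam) ^+ n.
  have [zn an _] := hz n; have [zSn aSn _] := hz n.+1.
  rewrite -[leRHS]mulrA -lnE; have [cc1 cc2] := cc n.
  rewrite lS in zSn cc2 aSn.
  apply: (link B0 (ln n) (c0 n.+1) _ zSn _ an aSn).
    by rewrite -lS.
  by move=> y yJ; rewrite ler_norml; lra.
have [L hL] := geometric_limit r0 r1 step.
have Le : L = f e.
  apply/eqP; rewrite -subr_eq0 -normr_le0.
  apply: (@ler_geometric _ (2^-1 `^ gam)
    (48 * B `^ q^-1 * l `^ gam / (1 - 2^-1 `^ gam) + `|X| * l `^ gam)) => // n.
  have [zn an _] := hz n.
  have ze : `|f (z n) - f e| <= `|X| * l `^ gam * (2^-1 `^ gam) ^+ n.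
    rewrite -mulrA -lnE.
    have := ce n; have := c0 n; have := c1 n => ? ? ?.
    have aux u v : 0 <= u -> u <= v -> v <= 1 -> v - u <= l / 2 ^+ n ->
        `|f v - f u| <= `|X| * (l / 2 ^+ n) `^ gam.
      move=> u0 uv v1 vul; apply: (le_trans (hf _ _ u0 uv v1)).
      apply: (@le_trans _ _ (`|X| * (v - u) `^ gam)).
        by rewrite ler_wpM2r ?powR_ge0// ler_norm.
      by rewrite ler_wpM2l// ler_powRl ?subr_ge0// ltW.
    have [h|h] := leP (z n) e; first by rewrite distrC aux//; lra.
    by rewrite aux//; lra.
  rewrite add0r mulrDl.
  have := hL n; move: ze; rewrite !ler_norml; lra.
have := hL 0%N; rewrite expr0 mulr1 z00 Le distrC /grr_cst.
rewrite (_ : 96 / (1 - 2^-1 `^ gam) / 2 * B `^ q^-1 * l `^ gam =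
  48 * B `^ q^-1 * l `^ gam / (1 - 2^-1 `^ gam))//.
by field; lra.
Qed.

(** The chains descending from a common point of [s, t] to s and to t are
    summed.  The qualitative hypothesis that f is gam-Hoelder replaces the
    Lebesgue differentiation of the general case. *)
Lemma garsia_rodemich_rumsey (X B : R) : holder_with gam X f -> 0 < B ->
  (\int[lebesgue_measure]_(z in `[0%R, 1%R])
    \int[lebesgue_measure]_(e in `[0%R, 1%R])
      (`|f z - f e| `^ q / `|z - e| `^ (q * gam + 2))%:E <= B%:E)%E ->
  holder_with gam (grr_cst * B `^ q^-1) f.
Proof.
have r1 := half_powR_lt1 gam0.
move=> hf B0 aB s t s0; rewrite le_eqVlt => /predU1P[<-|st] t1.
  by rewrite !subrr normr0 mulr_ge0 ?powR_ge0// mulr_ge0 ?powR_ge0// divr_ge0//; lra.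
have l0 : 0 < t - s by rewrite subr_gt0.
have [|z0 z0J az0] := exists_le_mean s0 st t1 B0 _ aB; first by move=> z _; exact: a_ge0.
have n2 n : 0 < 2 ^- n :> R by rewrite invr_gt0 exprn_gt0.
have n21 n : 2 ^- n <= 1 :> R by rewrite invf_le1 ?exprn_gt0// exprn_ege1// ler1n.
have nS n : 2 ^- n = 2 * 2 ^- n.+1 :> R by rewrite exprS invfM mulrA mulfV ?mul1r.
have m n : 0 < (t - s) * 2 ^- n by rewrite mulr_gt0.
have m1 n : (t - s) * 2 ^- n <= t - s by rewrite ler_piMr// ltW.
have mS n : (t - s) * 2 ^- n = 2 * ((t - s) * 2 ^- n.+1) by rewrite nS; ring.
have B1 : `|f s - f z0| <= grr_cst / 2 * B `^ q^-1 * (t - s) `^ gam.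
  apply: (@chain X (fun=> s)) => //.
  - by move=> n; have := m1 n; lra.
  - by move=> n; have := mS n; have := m n.+1; split; lra.
  - by move=> n; have := m n; lra.
  - by rewrite addrC subrK.
have B2 : `|f t - f z0| <= grr_cst / 2 * B `^ q^-1 * (t - s) `^ gam.
  apply: (@chain X (fun n => t - (t - s) / 2 ^+ n)) => //.
  - by move=> n; have := m1 n; lra.
  - by move=> n; have := m1 n; lra.
  - by move=> n; have := mS n; have := m n.+1; split; lra.
  - by move=> n; have := m n; lra.
  - by rewrite expr0 divr1; lra.
move: B1 B2; rewrite !ler_norml; lra.
Qed.

End grr.

Lemma grr_cst_ge0 (R : realType) (gam : R) : 0 < gam -> 0 <= grr_cst gam.
Proof. by move=> g0; rewrite divr_ge0// subr_ge0 ltW// half_powR_lt1. Qed.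

(** * Finiteness of the Gagliardo integral *)

Lemma is_derive_affine_powR (R : realType) (s z a e : R) : 0 < s * (e - z) ->
  is_derive e 1 (fun y => (s * (y - z)) `^ a) (a * (s * (e - z)) `^ (a - 1) * s).
Proof.
move=> h.
have dg : is_derive e 1 (fun y => s * (y - z)) s.
  by apply: is_derive_eq; rewrite /GRing.scale/= subr0; ring.
exact: (@is_derive1_comp _ (fun y => y `^ a) (fun y => s * (y - z)) e _ _
  (is_derive1_powR a h) dg).
Qed.

(** The sign s handles both sides of the singularity z at once. *)
Lemma integral_affine_powR (R : realType) (s z r a b : R) :
  s ^+ 2 = 1 -> -1 < r -> a < b -> (forall e, a <= e <= b -> 0 < s * (e - z)) ->
  (\int[lebesgue_measure]_(e in `[a, b]) ((s * (e - z)) `^ r)%:E =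
    (s / (r + 1) * (s * (b - z)) `^ (r + 1))%:E -
    (s / (r + 1) * (s * (a - z)) `^ (r + 1))%:E)%E.
Proof.
move=> s2 r1 ab h.
have cpow c : forall e, a <= e <= b -> {for e, continuous (fun y => (s * (y - z)) `^ c)}.
  move=> e eab; apply/differentiable_continuous/derivable1_diffP.
  by have [] := is_derive_affine_powR c (h e eab).
pose F e := s / (r + 1) * (s * (e - z)) `^ (r + 1).
have dF e : a <= e <= b -> is_derive e 1 F ((s * (e - z)) `^ r).
  move=> eab; have d := is_derive_affine_powR (r + 1) (h e eab).
  apply: is_derive_eq; rewrite /GRing.scale/= addrK.
  have r0 : r + 1 != 0 by rewrite gt_eqF//; lra.
  rewrite [LHS](_ : _ = s ^+ 2 * (s * (e - z)) `^ r); last by field.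
  by rewrite s2 mul1r.
have cF e : a <= e <= b -> {for e, continuous F}.
  move=> eab; apply/differentiable_continuous/derivable1_diffP.
  by have [] := dF e eab.
apply: (@continuous_FTC2 _ _ F) => //.
- by apply: continuous_in_subspaceT => e; rewrite inE/= in_itv/= => eab; apply: cpow.
- split.
  + move=> e; rewrite in_itv/= => /andP[h1 h2].
    by have [] := dF e ltac:(by rewrite !ltW).
  + by apply: cvg_at_right_filter; apply: cF; rewrite lexx ltW.
  + by apply: cvg_at_left_filter; apply: cF; rewrite lexx ltW.
- move=> e; rewrite in_itv/= => /andP[h1 h2].
  by rewrite derive1E; have [_] := dF e ltac:(by rewrite !ltW).
Qed.

(** The primitives are bounded up to the singularity since r + 1 > 0; monotone
    convergence along the complements of shrinking neighbourhoods of z. *)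
Lemma integral_dist_powR (R : realType) (z r : R) : -1 < r ->
  (\int[lebesgue_measure]_(e in `[(z - 1)%R, (z + 1)%R] `\ z)
     (`|e - z| `^ r)%:E <= (2 / (r + 1))%:E)%E.
Proof.
move=> r1.
have r0 : 0 < r + 1 by lra.
pose d n : R := n.+2%:R^-1.
have d0 n : 0 < d n by rewrite invr_gt0.
have d1 n : d n < 1 by rewrite invf_lt1// ltr1n.
pose F n := `[z - 1, z - d n] `|` `[z + d n, z + 1].
have FE : `[z - 1, z + 1] `\ z = \bigcup_n F n.
  apply/seteqP; split => [e /= [+ ez]|e [n _]].
    rewrite in_itv/= => e1.
    have ez0 : 0 < `|e - z| by rewrite normr_gt0 subr_eq0; apply/eqP.
    have [n hn] : exists n, d n <= `|e - z|.
      exists (Num.truncn `|e - z|^-1); rewrite /d invf_ple ?posrE//.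
      by rewrite ltW// (lt_trans (truncnS_gt _))// ltr_nat.
    exists n => //; have := d0 n; rewrite /F /= !in_itv/=.
    move: e1 hn; case: (ger0P (e - z)) => h e1 hn dn; [right|left]; lra.
  have := d0 n; rewrite /F /= !in_itv/= => dn [/andP[h1 h2]|/andP[h1 h2]];
  by split; [lra|move=> ez; lra].
have mf (A : set R) : measurable_fun A (fun e => (`|e - z| `^ r)%:E).
  apply/measurable_EFinP; apply: (measurableT_comp (measurable_powR _)).
  by apply: measurableT_comp => //; apply: measurable_funB.
have cv := @ge0_nondecreasing_set_cvg_integral _ (measurableTypeR R) R F
   (fun e => (`|e - z| `^ r)%:E) lebesgue_measure.
have nd : nondecreasing_seq F.
  move=> m n mn; apply/subsetPset => e; rewrite /F /= !in_itv/=.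
  have : d n <= d m by rewrite lef_pV2 ?posrE// ler_nat.
  by move=> dmn [/andP[h1 h2]|/andP[h1 h2]]; [left|right]; lra.
have mF n : measurable (F n) by exact: measurableU.
have f0 n e : F n e -> (0 <= (`|e - z| `^ r)%:E)%E by rewrite lee_fin powR_ge0.
have {}cv := cv nd mF (fun n => mf _) f0.
rewrite FE -(cvg_lim _ cv)//; apply: lime_le; first exact: cvgP cv.
apply: nearW => n; have := d0 n; have := d1 n => dn1 dn0.
rewrite ge0_integral_setU//; last 2 first.
- exact: mf.
- apply/disj_setPS => e [] /=; rewrite !in_itv/=; lra.
have pS (s : R) (a b : R) : s ^+ 2 = 1 -> a < b -> (forall e, a <= e <= b -> 0 < s * (e - z)) ->
  (\int[lebesgue_measure]_(e in `[a, b]) (`|e - z| `^ r)%:E =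
    (s / (r + 1) * (s * (b - z)) `^ (r + 1))%:E -
    (s / (r + 1) * (s * (a - z)) `^ (r + 1))%:E)%E.
  move=> s2 ab h; rewrite -(integral_affine_powR s2 r1 ab h).
  apply: eq_integral => e; rewrite inE/= in_itv/= => eab; congr ((_ `^ _)%:E).
  have sn : `|s| = 1 by move/eqP: s2; rewrite sqrf_eq1 => /orP[]/eqP->; rewrite ?normrN normr1.
  by rewrite -[RHS]gtr0_norm ?h// normrM sn mul1r.
rewrite (pS (-1)) ?(pS 1); last 6 first.
- by rewrite expr1n.
- lra.
- by move=> e; lra.
- by rewrite sqrrN expr1n.
- lra.
- by move=> e; lra.
have e1 : (-1 : R) * (z - 1 - z) = 1 by ring.
have e2 : 1 * (z + 1 - z) = 1 :> R by ring.
rewrite e1 e2 powR1 -!EFinB -EFinD lee_fin.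
have p1 := powR_ge0 (1 * (z + d n - z)) (r + 1).
have p2 := powR_ge0 ((-1) * (z - d n - z)) (r + 1).
have rV : 0 <= (r + 1)^-1 by rewrite invr_ge0 ltW.
have := mulr_ge0 rV p1; have := mulr_ge0 rV p2; lra.
Qed.

(** The integrand is at most H^q |z - e|^(q eps - 2), whose exponent is larger
    than -1 exactly when q eps > 1. *)
Lemma gagliardo_bound (R : realType) (gam eps q H : R) (f : R -> R) :
  0 < q -> 1 < q * eps -> holder_with (gam + eps) H f -> 0 <= H ->
  (\int[lebesgue_measure]_(z in `[0%R, 1%R])
    \int[lebesgue_measure]_(e in `[0%R, 1%R])
      (`|f z - f e| `^ q / `|z - e| `^ (q * gam + 2))%:E <=
   (H `^ q * (2 / (q * eps - 1)))%:E)%E.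
Proof.
move=> q0 qe hf H0.
pose r := q * eps - 2.
have rE : q * eps - 1 = r + 1 by rewrite /r; ring.
have r1 : -1 < r by rewrite /r; lra.
have c0 : 0 <= H `^ q * (2 / (q * eps - 1)).
  by rewrite mulr_ge0 ?powR_ge0// divr_ge0//; lra.
have D0 z e : 0 <= `|f z - f e| `^ q / `|z - e| `^ (q * gam + 2).
  by rewrite divr_ge0 ?powR_ge0.
have DH z e : 0 <= z <= 1 -> 0 <= e <= 1 -> e != z ->
    `|f z - f e| `^ q / `|z - e| `^ (q * gam + 2) <= H `^ q * `|e - z| `^ r.
  move=> z01 e01 ez; have ze0 : 0 < `|e - z| by rewrite normr_gt0 subr_eq0.
  have h : `|f z - f e| <= H * `|e - z| `^ (gam + eps).
    have [le|lt] := leP z e.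
      by rewrite (distrC (f z)) [X in X `^ _]ger0_norm ?subr_ge0//; apply: hf; lra.
    by rewrite (distrC e z) [X in X `^ _]gtr0_norm ?subr_gt0//; apply: hf; lra.
  rewrite (distrC z) ler_pdivrMr ?powR_gt0// -mulrA -powRD ?(gt_eqF ze0) ?implybT//.
  have -> : r + (q * gam + 2) = (gam + eps) * q by rewrite /r; ring.
  by rewrite powRrM -powRM ?powR_ge0// ler_powRl// ltW.
have inner z : 0 <= z <= 1 -> (\int[lebesgue_measure]_(e in `[0%R, 1%R])
      (`|f z - f e| `^ q / `|z - e| `^ (q * gam + 2))%:E <=
      (H `^ q * (2 / (q * eps - 1)))%:E)%E.
  move=> z01; pose S : set R := `[z - 1, z + 1] `\ z.
  apply: (@le_trans _ _ (\int[lebesgue_measure]_(e in S) ((H `^ q)%:E * (`|e - z| `^ r)%:E))%E).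
    apply: le_integral_restrict => [e _|e _|e].
    - by rewrite lee_fin.
    - by rewrite -EFinM lee_fin mulr_ge0 ?powR_ge0.
    have Se0 : (0 <= ((fun e => (H `^ q)%:E * (`|e - z| `^ r)%:E)%E \_ S) e)%E.
      by rewrite patchE; case: ifPn => // _; rewrite -EFinM lee_fin mulr_ge0 ?powR_ge0.
    rewrite patchE; case: ifPn => // /set_mem/=; rewrite in_itv/= => e01.
    have [ez|ez] := eqVneq e z.
      by subst e; rewrite subrr normr0 powR0 ?gt_eqF// mul0r.
    rewrite patchE mem_set.
    2: by rewrite /S /= in_itv/=; split; [lra|apply/eqP].
    by rewrite -EFinM lee_fin DH.
  rewrite ge0_integralZl_EFin ?powR_ge0//; last 2 first.
  - exact: measurableD.
  - apply/measurable_EFinP; apply: (measurableT_comp (measurable_powR _)).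
    by apply: measurableT_comp => //; apply: measurable_funB.
  rewrite EFinM lee_wpmul2l ?lee_fin ?powR_ge0// rE.
  exact: integral_dist_powR.
apply: (@le_trans _ _ (\int[lebesgue_measure]_(z in `[0%R, 1%R])
  (H `^ q * (2 / (q * eps - 1)))%:E)%E).
  apply: le_integral_restrict => [e _|e _|e].
  - by apply: integral_ge0 => ? _; rewrite lee_fin.
  - by rewrite lee_fin.
  rewrite !patchE; case: ifPn => // /set_mem/=; rewrite in_itv/=; exact: inner.
by rewrite integral_cst//= lebesgue_measure_itv/= lte01 oppr0 adde0 mule1.
Qed.

(** * Composition with a C2 function *)

Lemma lipschitz_of_derive (R : realType) (f : R -> R) (L : R) :
  (forall y, derivable f y 1) -> (forall y, `|derive1 f y| <= L) ->
  forall a b, `|f a - f b| <= L * `|a - b|.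
Proof.
move=> df fL.
have key a b : a < b -> `|f b - f a| <= L * `|b - a|.
  move=> ab; have [||c _ ->] := @MVT R f (derive1 f) a b ab.
  - by move=> c _; rewrite derive1E; apply: DeriveDef.
  - apply: continuous_subspaceT => c; apply/differentiable_continuous.
    exact/derivable1_diffP.
  by rewrite normrM ler_wpM2r.
move=> a b; have [ab|ba|->] := ltgtP a b.
- by rewrite distrC (distrC a) key.
- exact: key.
- by rewrite !subrr !normr0 mulr0.
Qed.

(** Mean value theorem for e |-> f (b1 + e (a1 - b1)) - f (b2 + e (a2 - b2)) on
    [0, 1].  Interpreted with a and b the values of two paths at two times, it
    bounds the Hoelder seminorm of a difference of compositions. *)
Lemma second_difference (R : realType) (f : R -> R) (L : R) :
  (forall y, derivable f y 1) -> (forall y, `|derive1 f y| <= L) ->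
  (forall a b, `|derive1 f a - derive1 f b| <= L * `|a - b|) ->
  forall a1 b1 a2 b2, `|(f a1 - f b1) - (f a2 - f b2)| <=
    L * `|(a1 - b1) - (a2 - b2)| + L * `|a2 - b2| * (`|a1 - a2| + `|b1 - b2|).
Proof.
move=> df fL dL a1 b1 a2 b2.
have L0 : 0 <= L by exact: le_trans (fL 0).
pose m b d e := b + e * d : R.
have dm (b d e : R) : is_derive e 1 (m b d) d.
  by apply: is_derive_eq; rewrite /GRing.scale/=; ring.
have dfm (b d e : R) : is_derive e 1 (fun e : R => f (m b d e)) (derive1 f (m b d e) * d).
  apply: (@is_derive1_comp _ f (m b d)); rewrite derive1E; exact: DeriveDef.
pose h (e : R) := f (m b1 (a1 - b1) e) - f (m b2 (a2 - b2) e).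
have dh (e : R) : is_derive e 1 h (derive1 f (m b1 (a1 - b1) e) * (a1 - b1) -
                             derive1 f (m b2 (a2 - b2) e) * (a2 - b2)).
  exact: is_deriveB.
have [|c] := @MVT R h _ 0 1 ltr01 (fun e _ => dh e).
  apply: continuous_subspaceT => c; apply/differentiable_continuous.
  by apply/derivable1_diffP; have [] := dh c.
rewrite in_itv/= => /andP[c0 c1].
have m1 b d : m b (d - b) 1 = d by rewrite /m; ring.
have m0 b d : m b d 0 = b by rewrite /m; ring.
rewrite {1 2}/h !m1 !m0 subr0 mulr1.
rewrite [f a1 - f b1 - _](_ : _ = f a1 - f a2 - (f b1 - f b2)); last ring.
move=> ->.
set u := derive1 f _; set v := derive1 f _.
rewrite [X in `|X|](_ : _ = u * ((a1 - b1) - (a2 - b2)) + (u - v) * (a2 - b2)); last ring.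
apply: (le_trans (ler_normD _ _)); rewrite !normrM; apply: lerD.
  by rewrite ler_wpM2r// fL.
rewrite [leRHS]mulrAC ler_wpM2r//; apply: (le_trans (dL _ _)); rewrite ler_wpM2l//.
rewrite [X in `|X|](_ : _ = c * (a1 - a2) + (1 - c) * (b1 - b2)); last by rewrite /m; ring.
apply: (le_trans (ler_normD _ _)); rewrite !normrM; apply: lerD.
  by rewrite ler_piMl// gtr0_norm// ltW.
by rewrite ler_piMl// ger0_norm; lra.
Qed.

(** * Picard iteration in a Hoelder ball *)

(** The first hypothesis is global, the second one only holds in the unit ball.
    Since H |-> (1 + H) / 4 has a fixed point below 1, every fixed point of G
    lies in the unit ball, so uniqueness is not restricted to the ball.  All
    limits are taken pointwise, which avoids the completeness of a function
    space; the Hoelder distance to the limit is recovered by applying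
    geometric_limit to increments. *)
Lemma picard (R : realType) (k : R) (G : (R -> R) -> R -> R) : 0 < k ->
  (forall z H, 0 <= H -> z 0 = 0 -> holder_with k H z ->
     G z 0 = 0 /\ holder_with k ((1 + H) / 4) (G z)) ->
  (forall z1 z2 h, z1 0 = 0 -> z2 0 = 0 -> holder_with k 1 z1 -> holder_with k 1 z2 -> 0 <= h ->
     holder_with k h (z1 \- z2) -> holder_with k (h / 2) (G z1 \- G z2)) ->
  exists z, [/\ z 0 = 0, holder_with k 1 z, (forall t, 0 <= t <= 1 -> G z t = z t) &
    forall z' H, 0 <= H -> z' 0 = 0 -> holder_with k H z' ->
      (forall t, 0 <= t <= 1 -> G z' t = z' t) ->
      forall t, 0 <= t <= 1 -> z' t = z t].
Proof.
move=> k0 bnd ctr.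
have r0 : 0 <= 2^-1 :> R by lra.
have r1 : 2^-1 < 1 :> R by lra.
have rn0 n : 0 <= 2^-1 ^+ n :> R by rewrite exprn_ge0.
have eq0 (a b c : R) : (forall n, `|a - b| <= c * 2^-1 ^+ n) -> a = b.
  move=> h; apply/eqP; rewrite -subr_eq0 -normr_le0.
  by apply: (@ler_geometric _ 2^-1 c) => // n; rewrite add0r.
pose y n := iter n G (fun=> 0).
have y1 n : y n 0 = 0 /\ holder_with k 1 (y n).
  elim: n => [|n [IH1 IH2]].
    by split=> // s t s0 st t1; rewrite subrr normr0 mul1r powR_ge0.
  have [g0 gh] := bnd _ _ ler01 IH1 IH2; split=> //.
  by apply: holder_with_le gh; lra.
have yS n : holder_with k (2 * 2^-1 ^+ n) (y n.+1 \- y n).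
  elim: n => [|n IH].
    by rewrite expr0 mulr1; apply: holder_with_le (holder_with_sub (y1 1%N).2 (y1 0%N).2); lra.
  have -> : 2 * 2^-1 ^+ n.+1 = 2 * 2^-1 ^+ n / 2 :> R by rewrite exprS; lra.
  have [? ?] := y1 n; have [? ?] := y1 n.+1.
  by apply: ctr => //; rewrite mulr_ge0.
have yS0 n t : 0 <= t <= 1 -> `|y n.+1 t - y n t| <= 2 * 2^-1 ^+ n.
  move=> t01; apply: (@holder_with_normr_le _ k _ (y n.+1 \- y n)) => //.
  by rewrite [LHS](_ : _ = y n.+1 0 - y n 0)// (y1 n).1 (y1 n.+1).1 subrr.
have /choice[z hz] : forall t, exists l, 0 <= t <= 1 ->
    forall n, `|y n t - l| <= 4 * 2^-1 ^+ n.
  move=> t; have [t01|/negP nt] := boolP (0 <= t <= 1); last by exists 0.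
  have [l hl] := geometric_limit r0 r1 (fun n => yS0 n t t01).
  by exists l => _ n; have := hl n; rewrite (_ : 2 / (1 - 2^-1) = 4)//; field.
have z0 : z 0 = 0.
  apply: (eq0 _ _ 4) => n; have := hz 0 _ n; rewrite (y1 n).1 distrC.
  by apply; rewrite lexx ler01.
have z1 : holder_with k 1 z.
  move=> s t s0 st t1; apply: (@ler_geometric _ 2^-1 8) => // n.
  have := (y1 n).2 s t s0 st t1.
  have := hz s ltac:(lra) n; have := hz t ltac:(lra) n.
  rewrite !ler_norml; lra.
have zy n : holder_with k (4 * 2^-1 ^+ n) (z \- y n).
  move=> s t s0 st t1 /=.
  have hS m : `|(y m.+1 t - y m.+1 s) - (y m t - y m s)| <=
      2 * (t - s) `^ k * 2^-1 ^+ m.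
    have := yS m s t s0 st t1 => /=.
    by rewrite mulrAC; congr (_ <= _); congr `|_|; ring.
  have [l hl] := geometric_limit r0 r1 hS.
  have -> : z t - y n t - (z s - y n s) = l - (y n t - y n s).
    rewrite -[l](eq0 (z t - z s) l (8 + 2 * (t - s) `^ k / (1 - 2^-1))); first ring.
    move=> m; have := hl m.
    have := hz s ltac:(lra) m; have := hz t ltac:(lra) m.
    rewrite mulrDl !ler_norml; lra.
  have := hl n; rewrite distrC (_ : 2 * (t - s) `^ k / (1 - 2^-1) = 4 * (t - s) `^ k).
    by rewrite mulrAC.
  by field.
have zG t : 0 <= t <= 1 -> G z t = z t.
  move=> t01; apply: (eq0 _ _ 6) => n.
  have h4 : 0 <= 4 * 2^-1 ^+ n :> R by rewrite mulr_ge0.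
  have [yn0 ynh] := y1 n.
  have c1 := ctr _ _ _ z0 yn0 z1 ynh h4 (zy n).
  have [Gz0 _] := bnd _ _ ler01 z0 z1; have [Gy0 _] := bnd _ _ ler01 yn0 ynh.
  have := holder_with_normr_le k0 c1 _ t01; rewrite /= Gz0 Gy0 subrr => /(_ erefl).
  have := hz t t01 n.+1; rewrite exprS /y iterS -/(y n) !ler_norml; lra.
exists z; split=> // z' H H0 z'0 z'h z'G.
have z'1 : holder_with k 1 z'.
  (* (1 + (1 + H / 2^n)) / 4 <= 1 + H / 2^(n+1) *)
  have hn n : holder_with k (1 + H * 2^-1 ^+ n) z'.
    elim: n => [|n IH]; first by rewrite expr0 mulr1; apply: holder_with_le z'h; lra.
    have Hn : 0 <= H * 2^-1 ^+ n by rewrite mulr_ge0.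
    have [_ g] := bnd _ _ (addr_ge0 ler01 Hn) z'0 IH.
    by apply: holder_with_le (holder_with_eq z'G g); rewrite exprS mulrCA; lra.
  move=> s t s0 st t1; apply: (@ler_geometric _ 2^-1 (H * (t - s) `^ k)) => // n.
  by have := hn n s t s0 st t1; rewrite mulrDl [in leRHS]mulrAC.
move=> t t01; apply: (eq0 _ _ 2) => n.
suff d : holder_with k (2 * 2^-1 ^+ n) (z' \- z).
  by apply: (holder_with_normr_le k0 d) => //=; rewrite z0 z'0 subrr.
elim: n => [|n IH].
  by rewrite expr0 mulr1; apply: holder_with_le (holder_with_sub z'1 z1); lra.
have -> : 2 * 2^-1 ^+ n.+1 = 2 * 2^-1 ^+ n / 2 :> R by rewrite exprS; lra.
apply: (holder_with_eq (f := G z' \- G z)); first by move=> u u01 /=; rewrite zG ?z'G.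
by apply: ctr => //; rewrite mulr_ge0.
Qed.

(** * The Green operator with a Young source *)

(** The solution y of - y'' = g dx on [0, 1] with y_0 = y_1 = 0: the second term
    is the slope that restores y_1 = 0, since by Fubini the integral of the
    first one over [0, 1] is that of xi g dx. *)
Definition green_operator {R : realType} (x g : R -> R) (t : R) : R :=
  \int[lebesgue_measure]_(u in `[0, t]) young_integral g x u 1
  - t * young_integral (fun xi => xi * g xi) x 0 1.

Lemma green_operator0 (R : realType) (x g : R -> R) : green_operator x g 0 = 0.
Proof. by rewrite /green_operator set_itv1 Rintegral_set1 mul0r subr0. Qed.

Section green_operator.
Context {R : realType} (gam kap X : R) (x : R -> R).
Context (gam0 : 0 < gam) (kap0 : 0 < kap) (kap1 : kap <= 1) (th1 : 1 < gam + kap).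
Context (X0 : 0 <= X) (hx : holder_with gam X x).
Let c0 : R := young_cst (gam + kap).

Definition green_cst : R := 1 + 2 * young_cst (gam + kap).

Let c0_ge0 : 0 <= c0. Proof. exact: young_cst_ge0. Qed.

Section integrand.
Context (A B : R) (g : R -> R).
Context (A0 : 0 <= A) (B0 : 0 <= B).
Context (gA : forall t, 0 <= t <= 1 -> `|g t| <= A) (hg : holder_with kap B g).

Let gid xi := xi * g xi.

(** On an interval of length at most 1 the Lipschitz factor xi is kap-Hoelder with
    the same constant. *)
Lemma holder_with_idM : holder_with kap (A + B) (fun xi => xi * g xi).
Proof.
move=> s t s0 st t1.
rewrite [X in `|X|](_ : _ = (t - s) * g t + s * (g t - g s)); last ring.
have ts : t - s <= (t - s) `^ kap.
  by rewrite -[leLHS]powRr1 ?subr_ge0// ler_powRr//; lra.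
apply: (le_trans (ler_normD _ _)); rewrite !normrM mulrDl; apply: lerD.
  by rewrite mulrC ler_pM// ?gA ?ger0_norm ?subr_ge0//; lra.
apply: le_trans (hg s0 st t1).
by rewrite ler_piMl// ger0_norm//; lra.
Qed.

Let Y u := young_integral g x u 1.
Let c := young_integral gid x 0 1.
Let K := (A + c0 * B) * X.

Let K0 : 0 <= K.
Proof. by rewrite /K mulr_ge0// addr_ge0// mulr_ge0. Qed.

(* u |-> int_u^1 g dx is the difference of two values of one primitive, hence
   gam-Hoelder, and its outer Lebesgue integral makes sense. *)
Let YE : exists I : R -> R,
  [/\ forall u, 0 <= u <= 1 -> Y u = I 1 - I u &
      forall s t, 0 <= s -> s <= t -> t <= 1 ->
        `|I t - I s| <= K * (t - s) `^ gam].
Proof.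
have [I hI] := young_integral_exists gam0 kap0 th1 X0 B0 hx hg.
exists I; split=> [u /andP[u0 u1]|s t s0 st t1].
  by apply: young_integralE => //; have [] := hI u 1 u0 u1 (lexx 1).
have [_ h] := hI s t s0 st t1.
have h2 : c0 * B * X * (t - s) `^ (gam + kap) <= c0 * B * X * (t - s) `^ gam.
  rewrite ler_wpM2l//; first by rewrite mulr_ge0// mulr_ge0.
  by rewrite ler_powRr ?lerDl ?(ltW kap0)//; lra.
have h3 : `|g s * (x t - x s)| <= A * (X * (t - s) `^ gam).
  by rewrite normrM ler_pM// ?gA ?hx//; lra.
move: h h3; rewrite /K !mulrDl !ler_norml -/c0; lra.
Qed.

Let Y_bound u : 0 <= u <= 1 -> `|Y u| <= K.
Proof.
move=> u01; have [I [IE hI]] := YE; rewrite IE//.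
apply: (le_trans (hI _ _ _ _ _)); try lra.
rewrite -[leRHS]mulr1 ler_wpM2l// powR_le1 ?(ltW gam0)//; lra.
Qed.

Lemma young_integral_integrable s t : 0 <= s -> t <= 1 ->
  (@lebesgue_measure R).-integrable `[s, t]
    (EFin \o (fun u => young_integral g x u 1)).
Proof.
move=> s0 t1.
rewrite -/Y; have cY : {within `[0, 1], continuous Y}.
  apply: (holder_with_continuous (k := gam) (H := K)) => // u v u0 uv v1.
  have [I [IE hI]] := YE; rewrite !IE; try lra.
  rewrite [X in `|X|](_ : _ = - (I v - I u)); last ring.
  by rewrite normrN hI.
have {}cY : {within `[s, t], continuous Y}.
  by apply: continuous_subspaceW cY; apply: subset_itvScc; rewrite bnd_simp.
by apply: continuous_compact_integrable => //; exact: segment_compact.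
Qed.

Lemma green_operator_incr s t : 0 <= s -> s <= t -> t <= 1 ->
  green_operator x g t - green_operator x g s =
  \int[lebesgue_measure]_(u in `[s, t]) young_integral g x u 1
  - (t - s) * young_integral (fun xi => xi * g xi) x 0 1.
Proof.
move=> s0 st t1; rewrite /green_operator -/c.
have := @Rintegral_itvB R Y (BLeft 0) (BRight t) s (young_integral_integrable (lexx 0) t1).
rewrite !bnd_simp => /(_ s0 st).
rewrite Rintegral_itv_obnd_cbnd; last first.
  apply: integrableS (young_integral_integrable s0 t1) => //.
  by apply: subset_itvr; rewrite bnd_simp.
rewrite -/Y => <-; ring.
Qed.

(** The image is Lipschitz: the outer integration gains the whole factor t - s
    from a bound on the inner Young integrals.  As xi g vanishes at 0, its
    integral over [0, 1] consists of the Young remainder alone. *)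
Lemma green_operator_bound s t : 0 <= s -> s <= t -> t <= 1 ->
  `|green_operator x g t - green_operator x g s| <= green_cst * (A + B) * X * (t - s).
Proof.
move=> s0 st t1; rewrite green_operator_incr// -/c.
have iY := young_integral_integrable s0 t1.
have h1 : `|\int[lebesgue_measure]_(u in `[s, t]) Y u| <= K * (t - s).
  apply: (le_trans (le_normr_Rintegral _ iY)) => //.
  have -> : K * (t - s) = \int[lebesgue_measure]_(u in `[s, t]) K.
    rewrite Rintegral_cst//= lebesgue_measure_itv/= lte_fin.
    by move: st; rewrite le_eqVlt => /predU1P[->|->//]; rewrite ltxx subrr.
  apply: le_Rintegral => //.
  - exact: integrable_norm.
  - apply: continuous_compact_integrable; first exact: segment_compact.
    by apply: continuous_subspaceT => ?; exact: cvg_cst.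
  - by move=> u /=; rewrite in_itv/= => ?; apply: Y_bound; lra.
have h2 : `|c| <= c0 * (A + B) * X.
  have [I hI] := young_integral_exists gam0 kap0 th1 X0 (addr_ge0 A0 B0) hx holder_with_idM.
  have [yI hI1] := hI 0 1 (lexx 0) ler01 (lexx 1).
  rewrite /c (young_integralE ler01 yI).
  by move: hI1; rewrite /gid !mul0r !subr0 powR1 mulr1.
have h3 : `|(t - s) * c| <= c0 * (A + B) * X * (t - s).
  by rewrite normrM mulrC [`|t - s|]ger0_norm ?subr_ge0// ler_wpM2r ?subr_ge0.
apply: (le_trans (ler_normB _ _)); apply: (le_trans (lerD h1 h3)).
rewrite -mulrDl ler_wpM2r ?subr_ge0// /K -mulrDl ler_wpM2r// /green_cst -/c0.
have := mulr_ge0 c0_ge0 A0; have := mulr_ge0 c0_ge0 B0; have := B0; lra.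
Qed.

End integrand.

Lemma green_operatorB (A1 A2 B1 B2 : R) (g1 g2 : R -> R) t :
  0 <= B1 -> 0 <= B2 ->
  (forall t, 0 <= t <= 1 -> `|g1 t| <= A1) -> (forall t, 0 <= t <= 1 -> `|g2 t| <= A2) ->
  holder_with kap B1 g1 -> holder_with kap B2 g2 -> 0 <= t <= 1 ->
  green_operator x (g1 \- g2) t = green_operator x g1 t - green_operator x g2 t.
Proof.
move=> B10 B20 gA1 gA2 hg1 hg2 /andP[t0 t1].
have YB (f1 f2 : R -> R) C1 C2 u : 0 <= C1 -> 0 <= C2 ->
    holder_with kap C1 f1 -> holder_with kap C2 f2 ->
    0 <= u -> u <= 1 ->
    young_integral (f1 \- f2) x u 1 = young_integral f1 x u 1 - young_integral f2 x u 1.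
  move=> C10 C20 hf1 hf2 u0 u1.
  have [I1 /(_ u 1 u0 u1 (lexx 1))[y1 _]] :=
    young_integral_exists gam0 kap0 th1 X0 C10 hx hf1.
  have [I2 /(_ u 1 u0 u1 (lexx 1))[y2 _]] :=
    young_integral_exists gam0 kap0 th1 X0 C20 hx hf2.
  rewrite (young_integralE u1 y1) (young_integralE u1 y2).
  exact: (young_integralE u1 (is_young_integralB y1 y2)).
have A10 : 0 <= A1 by apply: (le_trans (normr_ge0 _) (gA1 0 _)); rewrite lexx ler01.
have A20 : 0 <= A2 by apply: (le_trans (normr_ge0 _) (gA2 0 _)); rewrite lexx ler01.
have c1 := holder_with_idM gA1 hg1; have c2 := holder_with_idM gA2 hg2.
have := YB _ _ _ _ _ (addr_ge0 A10 B10) (addr_ge0 A20 B20) c1 c2 (lexx 0) ler01.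
rewrite [X in young_integral X](_ : _ = fun xi => xi * (g1 \- g2) xi); last first.
  by apply/funext => xi /=; rewrite mulrBr.
rewrite /green_operator => ->.
have -> : \int[lebesgue_measure]_(u in `[0, t]) young_integral (g1 \- g2) x u 1 =
    \int[lebesgue_measure]_(u in `[0, t])
      (young_integral g1 x u 1 - young_integral g2 x u 1).
  apply: eq_Rintegral => u; rewrite inE/= in_itv/= => /andP[u0 ut].
  by apply: YB hg1 hg2 _ _ => //; apply: le_trans t1.
have i1 := young_integral_integrable B10 gA1 hg1 (lexx 0) t1.
have i2 := young_integral_integrable B20 gA2 hg2 (lexx 0) t1.
by rewrite (RintegralB _ i1 i2)//; ring.
Qed.

End green_operator.

(** * The cutoff equation *)

(** If ||x||_(gam, p)^(2p) > M + 1 the cutoff vanishes and any Hoelder constant of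
    x will do; otherwise garsia_rodemich_rumsey applies with the bound M + 1, and
    (M + 1)^(1 / (2p)) <= M + 1. *)
Lemma cutoff_holder_with (R : realType) (gam eps p K M : R) (phi x : R -> R) :
  0 < gam -> 0 < eps -> 1 <= p -> (2 * p)^-1 < eps -> 0 < M ->
  is_cutoff M phi -> (supnorm `]0%R, +oo[ phi <= K%:E)%E ->
  holder_space (gam + eps) x ->
  exists X, [/\ 0 <= X, holder_with gam X x &
    `|G_cut phi gam p x| * X <= Num.max K 1 * grr_cst gam * (M + 1)].
Proof.
move=> g0 e0 p1 pe M0 [_ _ phi0 phi1] phiK hx.
have [H H0 hH] := holder_space_with hx.
have hHg : holder_with gam H x by apply: holder_with_weaken hH => //; lra.
have q0 : 0 < 2 * p by lra.
have qe : 1 < 2 * p * eps by rewrite -ltr_pdivrMl// mulr1.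
have M10 : 0 < M + 1 by lra.
have RHS0 : 0 <= Num.max K 1 * grr_cst gam * (M + 1).
  rewrite mulr_ge0 ?(ltW M10)// mulr_ge0 ?grr_cst_ge0//.
  by rewrite le_max ler01 orbT.
have := gagliardo_bound q0 qe hH H0.
rewrite /G_cut /gp_norm.
set N := (\int[lebesgue_measure]_(z in _) _)%E => Nle.
have N0 : (0 <= N)%E.
  apply: integral_ge0 => z _; apply: integral_ge0 => e _.
  by rewrite lee_fin divr_ge0 ?powR_ge0.
have [n NE] : exists n, N = n%:E.
  exists (fine N); rewrite fineK// ge0_fin_numE//.
  by apply: le_lt_trans Nle _; rewrite ltry.
have n0 : 0 <= n by rewrite -lee_fin -NE.
rewrite NE poweR_EFin /= -powRrM mulVf ?gt_eqF// powRr1//.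
have [nM|Mn] := leP n (M + 1); last first.
  by exists H; rewrite phi0// normr0 mul0r.
have phin : `|phi n| <= Num.max K 1.
  (* K bounds the cutoff on the open half-line only; at 0 its value is 1 *)
  move: n0; rewrite le_eqVlt => /predU1P[<-|n0].
    by rewrite phi1// normr1 le_max lexx orbT.
  by rewrite le_max (le_supnorm phiK)//= in_itv/= n0.
exists (grr_cst gam * (M + 1) `^ (2 * p)^-1); split.
- by rewrite mulr_ge0 ?powR_ge0 ?grr_cst_ge0.
- apply: (@garsia_rodemich_rumsey _ _ _ x g0 _ _ H) => //.
  + lra.
  + exact: holder_with_continuous hHg.
  + by rewrite -/N NE lee_fin.
rewrite mulrA; have gc := grr_cst_ge0 g0; apply: ler_pM.
- exact: mulr_ge0.
- exact: powR_ge0.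
- exact: ler_wpM2r.
rewrite -[leRHS]powRr1 ?(ltW M10)//; apply: ler_powR; first lra.
by rewrite invf_le1//; lra.
Qed.

Section contraction.
Context {R : realType} (gam kap X G L : R) (x sigma : R -> R).
Context (gam0 : 0 < gam) (kap0 : 0 < kap) (kap1 : kap <= 1) (th1 : 1 < gam + kap).
Context (X0 : 0 <= X) (hx : holder_with gam X x) (L0 : 0 <= L).
Context (sL : forall y, `|sigma y| <= L) (dsL : forall y, `|derive1 sigma y| <= L).
Context (ds : forall y, derivable sigma y 1).
Context (dsLip : forall a b, `|derive1 sigma a - derive1 sigma b| <= L * `|a - b|).
Context (small : green_cst gam kap * (`|G| * X) * L <= 8^-1).

Let g (z : R -> R) (xi : R) := G * sigma (z xi).

Let slip := lipschitz_of_derive ds dsL.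

Lemma normr_amplitude_comp z t : `|g z t| <= `|G| * L.
Proof. by rewrite normrM ler_wpM2l. Qed.

Lemma holder_with_amplitude_comp z H : holder_with kap H z -> holder_with kap (`|G| * L * H) (g z).
Proof.
move=> hz s t s0 st t1; rewrite /g -mulrBr normrM -!mulrA ler_wpM2l//.
apply: (le_trans (slip _ _)); rewrite ler_wpM2l//; exact: hz.
Qed.

Let GL0 : 0 <= `|G| * L. Proof. by rewrite mulr_ge0. Qed.

(* trades the Lipschitz bound of the operator for a kap-Hoelder one, as
   t - s <= 1 *)
Let to_kap s t c d : 0 <= s -> s <= t -> t <= 1 -> 0 <= c -> c * 8^-1 <= d ->
  green_cst gam kap * (`|G| * L * c) * X * (t - s) <= d * (t - s) `^ kap.
Proof.
move=> s0 st t1 c0' cd.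
have d0 : 0 <= d by apply: le_trans cd; rewrite mulr_ge0.
have ts : t - s <= (t - s) `^ kap.
  by rewrite -[leLHS]powRr1 ?subr_ge0// ler_powRr//; lra.
apply: ler_pM => //; last first.
- apply: le_trans cd; rewrite [leLHS](_ : _ = c * (green_cst gam kap * (`|G| * X) * L)); last ring.
  by rewrite ler_wpM2l.
- by rewrite subr_ge0.
- rewrite mulr_ge0// mulr_ge0// ?mulr_ge0//.
  rewrite /green_cst addr_ge0// mulr_ge0//; exact: young_cst_ge0.
Qed.

Lemma green_operator_self_map z H : 0 <= H -> z 0 = 0 -> holder_with kap H z ->
  green_operator x (g z) 0 = 0 /\ holder_with kap ((1 + H) / 4) (green_operator x (g z)).
Proof.
move=> H0 z0 hz; split; first exact: green_operator0.
move=> s t s0 st t1.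
have gH0 : 0 <= `|G| * L * H by rewrite mulr_ge0.
have := green_operator_bound gam0 kap0 kap1 th1 X0 hx GL0 gH0
  (fun t _ => normr_amplitude_comp z t) (holder_with_amplitude_comp hz) s0 st t1.
move=> /le_trans; apply.
rewrite (_ : `|G| * L + `|G| * L * H = `|G| * L * (1 + H)); last ring.
by apply: to_kap => //; lra.
Qed.

(** The difference of the integrands has supremum at most |G| L h and Hoelder
    constant at most 3 |G| L h, the unit bounds on z1 and z2 providing two of
    the three units; hence the total 4 h / 8. *)
Lemma green_operator_contraction z1 z2 h : z1 0 = 0 -> z2 0 = 0 ->
  holder_with kap 1 z1 -> holder_with kap 1 z2 -> 0 <= h -> holder_with kap h (z1 \- z2) ->
  holder_with kap (h / 2) (green_operator x (g z1) \- green_operator x (g z2)).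
Proof.
move=> z10 z20 hz1 hz2 h0 hz.
have GL10 : 0 <= `|G| * L * 1 by rewrite mulr1.
have z120 : (z1 \- z2) 0 = 0 by rewrite /= z10 z20 subrr.
apply: (holder_with_eq (f := green_operator x (g z1 \- g z2))).
  move=> t t01; apply: (green_operatorB gam0 kap0 kap1 th1 X0 hx GL10 GL10 _ _
    (holder_with_amplitude_comp hz1) (holder_with_amplitude_comp hz2) t01).
  - by move=> u _; exact: normr_amplitude_comp.
  - by move=> u _; exact: normr_amplitude_comp.
have dA t : 0 <= t <= 1 -> `|(g z1 \- g z2) t| <= `|G| * L * h.
  move=> t01; rewrite /g /= -mulrBr normrM -mulrA ler_wpM2l//.
  apply: (le_trans (slip _ _)); rewrite ler_wpM2l//.
  exact: (holder_with_normr_le kap0 hz z120 t01).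
have dH : holder_with kap (`|G| * L * (3 * h)) (g z1 \- g z2).
  move=> s t s0 st t1.
  rewrite [X in `|X|](_ : _ = G * ((sigma (z1 t) - sigma (z2 t)) -
    (sigma (z1 s) - sigma (z2 s)))); last by rewrite /g /=; ring.
  rewrite normrM -!mulrA ler_wpM2l//.
  apply: (le_trans (second_difference ds dsL dsLip _ _ _ _)).
  have p1 : `|z1 t - z2 t - (z1 s - z2 s)| <= h * (t - s) `^ kap by exact: hz.
  have p2 := hz1 s t s0 st t1; have p3 := hz2 s t s0 st t1.
  have p4 : `|z1 s - z2 s| <= h by apply: (holder_with_normr_le kap0 hz z120); lra.
  rewrite -mulrA -mulrDr ler_wpM2l//.
  have p5 : `|z1 s - z2 s| * (`|z1 t - z1 s| + `|z2 t - z2 s|) <=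
      h * ((t - s) `^ kap + (t - s) `^ kap).
    by apply: ler_pM => //; rewrite !mul1r in p2 p3; exact: lerD.
  lra.
have GLh0 : 0 <= `|G| * L * h by rewrite mulr_ge0.
have GL3h0 : 0 <= `|G| * L * (3 * h) by rewrite mulr_ge0// mulr_ge0.
move=> s t s0 st t1.
have := green_operator_bound gam0 kap0 kap1 th1 X0 hx GLh0 GL3h0 dA dH s0 st t1.
move=> /le_trans; apply.
rewrite (_ : `|G| * L * h + `|G| * L * (3 * h) = `|G| * L * (4 * h)); last ring.
by apply: to_kap => //; lra.
Qed.

End contraction.

Theorem theorem2p7 (R : realType) (gam kap eps p K : R) :
  0 < gam -> gam < 1 -> 0 < kap -> kap < 1 -> 1 < gam + kap ->
  0 < eps -> 1 <= p -> (2 * p)^-1 < eps ->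
  exists c1 : R, [/\ 0 < c1, c1 < 1 &
    forall M : R, 0 < M ->
    exists C : R, 0 < C /\
      forall (phi : R -> R) (sigma x : R -> R),
        is_cutoff M phi -> (supnorm `]0%R, +oo[ phi <= K%:E)%E ->
        holder_space (gam + eps) x ->
        bounded_C2 sigma ->
        (forall j : nat, (j <= 2)%N ->
           (supnorm setT (derive1n j sigma) <= (c1 / (M + 1))%:E)%E) ->
        exists z : R -> R,
          [/\ is_solution phi gam p sigma x kap z,
              (forall z' : R -> R, is_solution phi gam p sigma x kap z' ->
                 forall t : R, 0 <= t -> t <= 1 -> z' t = z t) &
              (holder_norm kap z <= C%:E)%E]].
Proof.
move=> gam0 gam1 kap0 kap1 th1 eps0 p1 pe.
(* c1 makes the factor 8^-1 required by the contraction: the M + 1 given by the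
   cutoff cancels, and N / (8 (N + 1)) <= 8^-1.  The cutoff takes the value 1,
   whence max K 1. *)
pose N := green_cst gam kap * (Num.max K 1 * grr_cst gam).
have N0 : 0 <= N.
  apply: mulr_ge0; last first.
    by apply: mulr_ge0; [rewrite le_max ler01 orbT|exact: grr_cst_ge0].
  by rewrite /green_cst addr_ge0// mulr_ge0//; exact: young_cst_ge0.
have N1 : 0 < 8 * (N + 1) by lra.
exists (8 * (N + 1))^-1; split.
- by rewrite invr_gt0.
- by rewrite invf_lt1//; lra.
move=> M M0; exists 2; split=> // phi sigma x cphi phiK hxe [dsig _ _] sigL.
have [X [X0 hx GX]] := cutoff_holder_with gam0 eps0 p1 pe M0 cphi phiK hxe.
have M1 : 0 < M + 1 by lra.
have [L LE] : exists L, L = (8 * (N + 1))^-1 / (M + 1) by eexists.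
rewrite -LE in sigL.
have L0 : 0 <= L by rewrite LE divr_ge0 ?invr_ge0 ?ltW.
have sL y : `|sigma y| <= L by apply: le_supnorm (sigL 0%N isT) _.
have dsL y : `|derive1 sigma y| <= L by apply: le_supnorm (sigL 1%N isT) _.
have ddsL y : `|derive1 (derive1 sigma) y| <= L by apply: le_supnorm (sigL 2%N isT) _.
have ds y : derivable sigma y 1 by exact: (dsig 0%N).
have dds y : derivable (derive1 sigma) y 1 by exact: (dsig 1%N).
have dsLip := lipschitz_of_derive dds ddsL.
set G := G_cut phi gam p x in GX *.
have small : green_cst gam kap * (`|G| * X) * L <= 8^-1.
  have b0 : 0 <= green_cst gam kap.
    by rewrite /green_cst addr_ge0// mulr_ge0//; exact: young_cst_ge0.
  apply: (@le_trans _ _ (N * (M + 1) * L)).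
    by rewrite ler_wpM2r// /N -[leRHS]mulrA ler_wpM2l.
  have -> : N * (M + 1) * L = N / (N + 1) * 8^-1.
    by rewrite LE; field; rewrite !gt_eqF//; lra.
  by rewrite ler_piMl// ler_pdivrMr; lra.
pose T z := green_operator x (fun xi => G * sigma (z xi)).
have [z [z0 hz zT zuniq]] := @picard R kap T kap0
  (green_operator_self_map gam0 kap0 (ltW kap1) th1 X0 hx L0 sL dsL ds small)
  (green_operator_contraction gam0 kap0 (ltW kap1) th1 X0 hx L0 sL dsL ds dsLip small).
have z1 t : 0 <= t <= 1 -> `|z t| <= 1 by exact: holder_with_normr_le kap0 hz z0.
have incr y H s t : 0 <= H -> holder_with kap H y -> 0 <= s -> s <= t -> t <= 1 ->
    T y t - T y s = \int[lebesgue_measure]_(u in `[s, t])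
       young_integral (fun xi => G * sigma (y xi)) x u 1
     - (t - s) * young_integral (fun xi => xi * (G * sigma (y xi))) x 0 1.
  move=> H0 hy s0 st t1.
  apply: (green_operator_incr gam0 kap0 th1 X0 hx (A := `|G| * L) (B := `|G| * L * H)) => //.
  - by apply: mulr_ge0 => //; apply: mulr_ge0.
  - by move=> u _; exact: (normr_amplitude_comp _ sL).
  - apply: holder_with_amplitude_comp => //.
(* z_0 = 0, so the increments from 0 determine z and a solution is the same
   thing as a fixed point *)
exists z; split.
- split=> //; first exact: (holder_with_holder_space kap0 hz z1).
  by move=> s t s0 st t1; rewrite -(incr z 1)// !zT//; lra.
- move=> z' [z'h z'0 z'eq] t t0 t1.
  have [H H0 hz'] := holder_space_with z'h.
  apply: (zuniq z' H) => //; last by rewrite t0.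
  move=> u /andP[u0 u1]; have := z'eq 0 u (lexx 0) u0 u1.
  by rewrite -(incr z' H)// z'0 /T green_operator0 !subr0.
- by apply: (le_trans (holder_with_holder_norm hz z1)); rewrite lee_fin.
Qed.
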